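(* Let $(X,E)$ be a locale, $S$ a nonempty finite set of states with interaction $\phi$, $\nu$ a probability measure on $S$ with $\nu(\{s\})>0$ for all $s\in S$, and $\mu=\nu^{\otimes X}$. Let $G$ be a torsion free group acting on the locale $(X,E)$ such that the action of $G$ on $X$ is free, and suppose that the interaction $\phi$ is irreducibly quantified. Then there is an isomorphism \[ Z^1_{\mathrm{col}}(S^X)^G/\partial\bigl(C^0_{\mathrm{col}}(S^X)^G\bigr)\cong \mathrm{Hom}_{\mathbb Z}(G,H^0_{\mathrm{col}}(S^X)), \] where the right-hand side is the space of group homomorphisms from $G$ to the additive group $H^0_{\mathrm{col}}(S^X)$. In particular, if the maximal abelian quotient of $G$ is finitely generated of rank $d$, then there is a decomposition \[ Z^1_{\mathrm{col}}(S^X)^G\cong\partial\bigl(C^0_{\mathrm{col}}(S^X)^G\bigr)\oplus\bigoplus_{j=1}^d H^0_{\mathrm{col}}(S^X). \]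
   Context: **Setting.** A locale $(X,E)$ is a connected, locally finite, simple (no loops) symmetric directed graph with vertex set $X$ and edge set $E\subset X\times X$ (so $(x,y)\in E$ iff $(y,x)\in E$). For $e=(o(e),t(e))\in E$ put $\bar e=(t(e),o(e))$. An interaction is a map $\phi\colon S\times S\to S\times S$ such that for every $(s_1,s_2)$ with $\phi(s_1,s_2)\ne(s_1,s_2)$ one has $\hat\imath\circ\phi\circ\hat\imath\circ\phi(s_1,s_2)=(s_1,s_2)$, where $\hat\imath$ exchanges the two components. For $\Lambda\subset X$ let $S^\Lambda=\prod_{x\in\Lambda}S$ and $E_\Lambda=E\cap(\Lambda\times\Lambda)$. For $\eta\in S^\Lambda$ and $e\in E_\Lambda$, $\eta^e\in S^\Lambda$ is defined by $(\eta^e_{o(e)},\eta^e_{t(e)})=\phi(\eta_{o(e)},\eta_{t(e)})$ and $\eta^e_x=\eta_x$ for $x\ne o(e),t(e)$. Put $\Phi_\Lambda=\{(\eta,\eta^e)\mid\eta\in S^\Lambda,e\in E_\Lambda,\eta^e\ne\eta\}$. A path in $S^\Lambda$ from $\eta$ to $\eta'$ is a sequence $\eta=\eta^0,\dots,\eta^N=\eta'$ with $(\eta^{i-1},\eta^i)\in\Phi_\Lambda$ for all $i$; it is closed if $\eta^N=\eta^0$. **Irreducibly quantified.** A ($\nu$-regularized) conserved quantity is a map $\xi\colon S\to\mathbb R$ with $E_\nu[\xi]=0$ and $\xi(s_1')+\xi(s_2')=\xi(s_1)+\xi(s_2)$ whenever $(s_1',s_2')=\phi(s_1,s_2)$. The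 interaction is irreducibly quantified if for every locale $(Y,F)$ with finite vertex set $Y$ and all $\eta,\eta'\in S^Y$ such that $\sum_{y\in Y}\xi(\eta_y)=\sum_{y\in Y}\xi(\eta'_y)$ for every conserved quantity $\xi$, there is a path from $\eta$ to $\eta'$ in $S^Y$ (with transitions along the edges in $F$). **Co-local functions.** $\mathscr I$ is the set of finite subsets of $X$, directed by inclusion. For $\Lambda\in\mathscr I$, $C(S^\Lambda)$ is the space of functions $S^\Lambda\to\mathbb R$. Write $\mu$ also for the pushforward of $\mu$ to $S^\Lambda$, and $\mu(\eta)=\mu(\{\eta\})$. For $\Lambda\subset\Lambda'$ in $\mathscr I$, with projection $\mathrm{pr}_\Lambda\colon S^{\Lambda'}\to S^\Lambda$, the conditional expectation $\pi^\Lambda\colon C(S^{\Lambda'})\to C(S^\Lambda)$ is $\pi^\Lambda f(\eta)=\frac1{\mu(\eta)}\sum_{\eta'\in S^{\Lambda'},\,\mathrm{pr}_\Lambda(\eta')=\eta}f(\eta')\mu(\eta')$. Put $C^0(S^\Lambda)=\{f\in C(S^\Lambda)\mid E_\mu[f]=0\}$ and $C^0_{\mathrm{col}}(S^X)=\varprojlim_{\Lambda\in\mathscr I}C^0(S^\Lambda)$ along the maps $\pi^\Lambda$. **Co-local forms.** $C^1(S^\Lambda)$ is the space of functions $\omega\colon\Phi_\Lambda\to\mathbb R$ with $\omega(\eta',\eta)=-\omega(\eta,\eta')$. For $e\in E_\Lambda$ put $\omega_e(\eta)=\omega((\eta,\eta^e))$ if $\eta^e\neq\eta$ and $\omega_e(\eta)=0$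 otherwise; this embeds $C^1(S^\Lambda)$ in $\prod_{e\in E_\Lambda}C(S^\Lambda)$. For $\Lambda\subset\Lambda'$, $\pi^\Lambda(\omega_e)_{e\in E_{\Lambda'}}=(\pi^\Lambda\omega_e)_{e\in E_\Lambda}$ defines $\pi^\Lambda\colon C^1(S^{\Lambda'})\to C^1(S^\Lambda)$. A form $\omega\in C^1(S^\Lambda)$ is closed if $\sum_{i=1}^N\omega(\eta^{i-1},\eta^i)=0$ for every closed path $(\eta^0,\dots,\eta^N)$ in $S^\Lambda$. $Z^1(S^\Lambda)$ is the space of closed forms; the $\pi^\Lambda$ preserve closed forms, and $Z^1_{\mathrm{col}}(S^X)=\varprojlim_{\Lambda\in\mathscr I}Z^1(S^\Lambda)$. The differential $\partial_\Lambda f(\eta,\eta')=f(\eta')-f(\eta)$ commutes with the $\pi^\Lambda$ and induces $\partial\colon C^0_{\mathrm{col}}(S^X)\to Z^1_{\mathrm{col}}(S^X)$; $H^0_{\mathrm{col}}(S^X)=\ker\partial$. **Group action.** $G$ acts on $(X,E)$ by graph automorphisms. For $\sigma\in G$ and $\eta\in S^\Lambda$, $\sigma(\eta)=(\eta_{\sigma^{-1}(x)})_{x\in\sigma(\Lambda)}\in S^{\sigma(\Lambda)}$; $\sigma(f)(\eta)=f(\sigma^{-1}(\eta))$ maps $C(S^\Lambda)$ to $C(S^{\sigma(\Lambda)})$, and $\sigma(\omega)(\varphi)=\omega(\sigma^{-1}(\varphi))$ maps forms on $S^\Lambda$ to forms on $S^{\sigma(\Lambda)}$. These are compatible with the $\pi^\Lambda$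 and $\partial$, so $G$ acts on $C^0_{\mathrm{col}}(S^X)$ and $Z^1_{\mathrm{col}}(S^X)$ by $\sigma((f^\Lambda)_\Lambda)^{\sigma(\Lambda)}=\sigma(f^\Lambda)$. A superscript $G$ denotes invariants. *)

(* Defs.v *)
From HB Require Import structures.
From mathcomp Require Import all_boot all_order all_algebra finmap.
From mathcomp Require Import generic_quotient ring_quotient.
From mathcomp Require Import boolp classical_sets functions cardinality reals.

Set Implicit Arguments.
Unset Strict Implicit.
Unset Printing Implicit Defensive.

Import Order.TTheory GRing.Theory Num.Theory.

Local Open Scope fset_scope.
Local Open Scope ring_scope.
Local Open Scope quotient_scope.

(* An alias is needed because canonical structures cannot be keyed on a
   dependent function type. *)
Definition dprod (R : pzRingType) (I : Type) (V : I -> lmodType R) : Type :=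
  forall i, V i.

Section DirectProduct.
Context (R : pzRingType) (I : Type) (V : I -> lmodType R).
Implicit Types (f g h : dprod V) (a b : R).

HB.instance Definition _ := gen_eqMixin (dprod V).
HB.instance Definition _ := gen_choiceMixin (dprod V).

Definition dprod_zero : dprod V := fun=> 0.
Definition dprod_opp f : dprod V := fun i => - f i.
Definition dprod_add f g : dprod V := fun i => f i + g i.
Definition dprod_scale a f : dprod V := fun i => a *: f i.

Fact dprod_addA : associative dprod_add.
Proof. by move=> f g h; apply: functional_extensionality_dep => i; exact: addrA. Qed.

Fact dprod_addC : commutative dprod_add.
Proof. by move=> f g; apply: functional_extensionality_dep => i; exact: addrC. Qed.

Fact dprod_add0 : left_id dprod_zero dprod_add.
Proof. by move=> f; apply: functional_extensionality_dep => i; exact: add0r. Qed.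

Fact dprod_addN : left_inverse dprod_zero dprod_opp dprod_add.
Proof. by move=> f; apply: functional_extensionality_dep => i; exact: addNr. Qed.

HB.instance Definition _ := GRing.isZmodule.Build (dprod V)
  dprod_addA dprod_addC dprod_add0 dprod_addN.

Fact dprod_scaleA a b f : dprod_scale a (dprod_scale b f) = dprod_scale (a * b) f.
Proof. by apply: functional_extensionality_dep => i; exact: scalerA. Qed.

Fact dprod_scale1 : left_id 1 dprod_scale.
Proof. by move=> f; apply: functional_extensionality_dep => i; exact: scale1r. Qed.

Fact dprod_scaleDr : right_distributive dprod_scale +%R.
Proof. by move=> a f g; apply: functional_extensionality_dep => i; exact: scalerDr. Qed.

Fact dprod_scaleDl f : {morph dprod_scale^~ f : a b / a + b}.
Proof. by move=> a b; apply: functional_extensionality_dep => i; exact: scalerDl. Qed.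

HB.instance Definition _ := GRing.Zmodule_isLmodule.Build R (dprod V)
  dprod_scaleA dprod_scale1 dprod_scaleDr dprod_scaleDl.

End DirectProduct.

Record subspace (R : pzRingType) (V : lmodType R) := Subspace {
  carrier :> V -> Prop;
  carrier0 : carrier 0;
  carrierP : forall (a : R) u v, carrier u -> carrier v -> carrier (a *: u + v)
}.

Definition mem_subspace (R : pzRingType) (V : lmodType R) (U : subspace V) :
  {pred V} := fun v => `[< U v >].

Definition subspace_type (R : pzRingType) (V : lmodType R) (U : subspace V) :
  Type := {v : V | v \in mem_subspace U}.

Section SubspaceType.
Context (R : pzRingType) (V : lmodType R) (U : subspace V).

Fact mem_subspace_closed : submod_closed (mem_subspace U).
Proof.
split=> [|a u v /asboolP Uu /asboolP Uv]; apply/asboolP; first exact: carrier0.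
exact: carrierP.
Qed.

HB.instance Definition _ :=
  GRing.isSubmodClosed.Build R V (mem_subspace U) mem_subspace_closed.

HB.instance Definition _ := [isSub of subspace_type U for @sval _ _].
HB.instance Definition _ := [Choice of subspace_type U by <:].
HB.instance Definition _ := [SubChoice_isSubLmodule of subspace_type U by <:].

End SubspaceType.

Coercion subspace_type : subspace >-> Sortclass.


Definition quotient_space (R : pzRingType) (V : lmodType R) (U : subspace V) :
  Type := Quotient.quot (mem_subspace U).

Section QuotientSpace.
Context (R : pzRingType) (V : lmodType R) (U : subspace V).
Implicit Types (a b : R).

Local Notation Q := (quotient_space U).

HB.instance Definition _ := GRing.Zmodule.on Q.
HB.instance Definition _ :=
  EqQuotient.copy Q (Quotient.quot (mem_subspace U)).

Definition quotient_scale a : Q -> Q := lift_op1 Q ( *:%R a).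

Fact pi_quotient_scale a : {morph \pi_Q : v / a *: v >-> quotient_scale a v}.
Proof.
move=> v; unlock quotient_scale; apply/eqP.
rewrite -Quotient.idealrBE -scalerBr rpredZ // Quotient.idealrBE.
by rewrite reprK.
Qed.

Fact pi_quotient_add : {morph \pi_Q : v w / v + w}.
Proof. exact: Quotient.pi_add. Qed.

Fact quotient_scaleA a b (q : Q) :
  quotient_scale a (quotient_scale b q) = quotient_scale (a * b) q.
Proof. by rewrite -[q]reprK -!pi_quotient_scale scalerA. Qed.

Fact quotient_scale1 : left_id 1 quotient_scale.
Proof. by move=> q; rewrite -[q]reprK -pi_quotient_scale scale1r. Qed.

Fact quotient_scaleDr : right_distributive quotient_scale +%R.
Proof.
move=> a p q; rewrite -[p]reprK -[q]reprK.
by rewrite -pi_quotient_add -!pi_quotient_scale -pi_quotient_add scalerDr.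
Qed.

Fact quotient_scaleDl (q : Q) : {morph quotient_scale^~ q : a b / a + b}.
Proof.
move=> a b; rewrite -[q]reprK -!pi_quotient_scale -pi_quotient_add.
by rewrite scalerDl.
Qed.

HB.instance Definition _ := GRing.Zmodule_isLmodule.Build R Q
  quotient_scaleA quotient_scale1 quotient_scaleDr quotient_scaleDl.

End QuotientSpace.

Definition isomorphic (R : pzRingType) (V W : lmodType R) : Prop :=
  exists f : {linear V -> W}, bijective f.

Section Abelianization.
Context (G : groupType).
Implicit Types (x y z : G).

Inductive commutator_subgroup : G -> Prop :=
| commutator_subgroup_comm x y : commutator_subgroup [~ x, y]%g
| commutator_subgroup1 : commutator_subgroup 1%g
| commutator_subgroupM x y : commutator_subgroup x -> commutator_subgroup y ->
    commutator_subgroup (x * y)%g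
| commutator_subgroupV x : commutator_subgroup x ->
    commutator_subgroup (x^-1)%g.

Definition ab_equiv x y : bool := `[< commutator_subgroup (x^-1 * y)%g >].

Fact commutator_subgroupJ x y :
  commutator_subgroup x -> commutator_subgroup (y^-1 * x * y)%g.
Proof.
move=> Dx; have -> : (y^-1 * x * y = x * [~ x, y])%g.
  by rewrite /commg /conjg mulVKg mulgA.
by apply: commutator_subgroupM => //; exact: commutator_subgroup_comm.
Qed.

Fact ab_equiv_is_equiv : equiv_class_of ab_equiv.
Proof.
split=> [x|x y|y x z].
- by apply/asboolP; rewrite mulVg; exact: commutator_subgroup1.
- by apply/asboolP/asboolP => /commutator_subgroupV; rewrite invgM invgK.
- move=> /asboolP Dxy /asboolP Dyz; apply/asboolP.
  have -> : (x^-1 * z = (x^-1 * y) * (y^-1 * z))%g by rewrite mulgA mulgK.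
  exact: commutator_subgroupM.
Qed.

Canonical ab_equiv_equiv := EquivRelPack ab_equiv_is_equiv.
Canonical ab_encModRel := defaultEncModRel ab_equiv.

Definition abelianization : Type := {eq_quot ab_equiv}.

Local Notation A := abelianization.

HB.instance Definition _ := Choice.on A.
HB.instance Definition _ := EqQuotient.copy A {eq_quot ab_equiv}.

Definition ab_zero : A := \pi_A 1%g.
Definition ab_opp (a : A) : A := \pi_A (repr a)^-1%g.
Definition ab_add (a b : A) : A := \pi_A (repr a * repr b)%g.

Fact ab_eqP x y : reflect (commutator_subgroup (x^-1 * y)%g) (\pi_A x == \pi_A y).
Proof. by rewrite piE; exact: asboolP. Qed.

Fact ab_reprP x : commutator_subgroup ((repr (\pi_A x))^-1 * x)%g.
Proof. by apply/ab_eqP; rewrite reprK. Qed.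

Fact ab_addE x y : ab_add (\pi_A x) (\pi_A y) = \pi_A (x * y)%g.
Proof.
apply/eqP/ab_eqP; rewrite invgM.
set b := repr _; set a := repr _.
have -> : (b^-1 * a^-1 * (x * y) = (b^-1 * y) * (y^-1 * (a^-1 * x) * y))%g.
  by rewrite !mulgA mulgK.
by apply: commutator_subgroupM; [|apply: commutator_subgroupJ]; exact: ab_reprP.
Qed.

Fact ab_oppE x : ab_opp (\pi_A x) = \pi_A (x^-1)%g.
Proof.
apply/eqP/ab_eqP; rewrite invgK; set a := repr _.
have -> : (a * x^-1 = x^-1^-1 * (x^-1 * a) * x^-1)%g.
  by rewrite invgK mulgA mulgV mul1g.
apply: commutator_subgroupJ.
by have /commutator_subgroupV := ab_reprP x; rewrite invgM invgK.
Qed.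

Fact ab_surj (a : A) : exists x, a = \pi_A x.
Proof. by exists (repr a); rewrite reprK. Qed.

Fact ab_addA : associative ab_add.
Proof.
move=> a b c; have [x ->] := ab_surj a; have [y ->] := ab_surj b.
have [z ->] := ab_surj c.
by rewrite !ab_addE mulgA.
Qed.

Fact ab_addC : commutative ab_add.
Proof.
move=> a b; have [x ->] := ab_surj a; have [y ->] := ab_surj b.
 rewrite !ab_addE; apply/eqP/ab_eqP.
have -> : ((x * y)^-1 * (y * x) = [~ y, x])%g.
  by rewrite /commg /conjg invgM !mulgA.
exact: commutator_subgroup_comm.
Qed.

Fact ab_add0 : left_id ab_zero ab_add.
Proof. by move=> a; have [x ->] := ab_surj a; rewrite ab_addE mul1g. Qed.

Fact ab_addN : left_inverse ab_zero ab_opp ab_add.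
Proof. by move=> a; have [x ->] := ab_surj a; rewrite ab_oppE ab_addE mulVg. Qed.

HB.instance Definition _ :=
  GRing.isZmodule.Build A ab_addA ab_addC ab_add0 ab_addN.

End Abelianization.

Definition finitely_generated (A : zmodType) : Prop :=
  exists (n : nat) (g : 'I_n -> A),
    forall a, exists c : 'I_n -> int, a = \sum_i g i *~ c i.

Definition Z_independent (A : zmodType) (n : nat) (b : 'I_n -> A) : Prop :=
  forall c : 'I_n -> int, \sum_i b i *~ c i = 0 -> forall i, c i = 0.

Definition has_rank (A : zmodType) (d : nat) : Prop :=
  (exists b : 'I_d -> A, Z_independent b) /\
  (forall n (b : 'I_n -> A), Z_independent b -> (n <= d)%N).

Definition torsion_free (G : groupType) : Prop :=
  forall (s : G) (n : nat), (0 < n)%N -> (s ^+ n)%g = 1%g -> s = 1%g.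

Record is_locale (X : Type) (E : rel X) : Prop := IsLocale {
  locale_sym : symmetric E;
  locale_irr : irreflexive E;
  locale_connected : forall x y, exists2 p, path E x p & last x p = y;
  locale_finite : forall x, finite_set [set y | E x y]
}.

Definition is_interaction (S : finType) (phi : S * S -> S * S) : Prop :=
  forall s, phi s != s -> swap_pair (phi (swap_pair (phi s))) = s.

Notation config Y S := {ffun Y -> S}.

Section Configurations.
Context (R : realType) (Y S : finType) (F : rel Y).
Context (phi : S * S -> S * S) (nu : S -> R).
Implicit Types (eta : config Y S) (e : Y * Y).

Definition update eta e : config Y S :=
  [ffun z => if z == e.1 then (phi (eta e.1, eta e.2)).1
             else if z == e.2 then (phi (eta e.1, eta e.2)).2
             else eta z].

Definition transition : rel (config Y S) := fun eta eta' =>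
  [exists e : Y * Y, [&& F e.1 e.2, eta' == update eta e & eta' != eta]].

Definition transitions : finType :=
  {p : config Y S * config Y S | transition p.1 p.2}.

Definition has_path eta eta' : Prop :=
  exists2 s, path transition eta s & last eta s = eta'.

(* The marginal on the finite set Y of the infinite product measure; only
   these finite marginals occur. *)
Definition product_measure eta : R := \prod_(y : Y) nu (eta y).

Definition expectation (f : config Y S -> R) : R :=
  \sum_eta f eta * product_measure eta.

Definition differential (f : config Y S -> R) : transitions -> R :=
  fun p => f (val p).2 - f (val p).1.

Section Forms.
Context (w : transitions -> R).

(* Extension by zero from transitions to all pairs of configurations. *)
Definition form_value (p : config Y S * config Y S) : R :=
  oapp w 0 (insub p).

(* For an edge e, the pair (eta, update eta e) is a transition exactly when
   update eta e != eta, so the value is 0 in the remaining case. *)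
Definition form_component e eta : R := form_value (eta, update eta e).

Definition is_form : Prop :=
  forall p q : transitions, val q = swap_pair (val p) -> w q = - w p.

Definition is_closed_form : Prop :=
  forall eta s, path transition eta s -> last eta s = eta ->
    \sum_(p <- zip (eta :: s) s) form_value p = 0.

End Forms.

End Configurations.

Section Conserved.
Context (R : realType) (S : finType) (phi : S * S -> S * S) (nu : S -> R).

Definition conserved_quantity (xi : S -> R) : Prop :=
  \sum_s xi s * nu s = 0 /\
  forall s, xi (phi s).1 + xi (phi s).2 = xi s.1 + xi s.2.

Definition irreducibly_quantified : Prop :=
  forall (Y : finType) (F : rel Y), is_locale F ->
  forall eta eta' : config Y S,
    (forall xi, conserved_quantity xi ->
       \sum_y xi (eta y) = \sum_y xi (eta' y)) ->
    has_path F phi eta eta'.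

End Conserved.

Section Colocal.
Context (R : realType) (X : choiceType) (S : finType) (E : rel X).
Context (phi : S * S -> S * S) (nu : S -> R).
Implicit Types (L M : {fset X}).

Definition edge_in L : rel L := fun x y => E (val x) (val y).

Definition restriction L M (LM : L `<=` M) (eta : config M S) : config L S :=
  [ffun x => eta (fincl LM x)].

Definition conditional_expectation L M (LM : L `<=` M)
    (f : config M S -> R) : config L S -> R :=
  fun eta => (product_measure nu eta)^-1 *
    \sum_(eta' | restriction LM eta' == eta) f eta' * product_measure nu eta'.

Definition function_space L : lmodType R := config L S -> R^o.
Definition form_space L : lmodType R := transitions (@edge_in L) phi -> R^o.

Definition function_families : lmodType R := dprod function_space.
Definition form_families : lmodType R := dprod form_space.

Definition family_differential (f : function_families) : form_families :=
  fun L => differential (f L).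

Definition colocal_function (f : function_families) : Prop :=
  (forall L, expectation nu (f L) = 0) /\
  (forall L M (LM : L `<=` M), conditional_expectation LM (f M) = f L).

(* The second clause says that the image of w M under the projection to L is
   w L, both forms being viewed as families of components over the edges. *)
Definition colocal_closed_form (w : form_families) : Prop :=
  (forall L, is_form (w L) /\ is_closed_form (w L)) /\
  (forall L M (LM : L `<=` M) (e : L * L), edge_in e.1 e.2 ->
     conditional_expectation LM
       (form_component (w M) (fincl LM e.1, fincl LM e.2)) =
     form_component (w L) e).

Fact conditional_expectation_linear L M (LM : L `<=` M) (a : R)
    (f g : function_space M) :
  conditional_expectation LM (a *: f + g) =
  a *: (conditional_expectation LM f : function_space L) +
  (conditional_expectation LM g : function_space L).
Proof.
apply/funext => eta; rewrite /conditional_expectation /= !fctE.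
rewrite scalerAr -mulrDr; congr (_ * _).
rewrite scaler_sumr -big_split /=; apply: eq_bigr => eta' _.
by rewrite mulrDl scalerAl.
Qed.

Fact expectation_linear L (a : R) (f g : function_space L) :
  expectation nu (a *: f + g) = a * expectation nu f + expectation nu g.
Proof.
rewrite /expectation mulr_sumr -big_split /=; apply: eq_bigr => eta _.
by rewrite !fctE mulrDl -mulrA.
Qed.

Fact form_value_linear L (a : R) (v w : form_space L) p :
  form_value (a *: v + w) p = a * form_value v p + form_value w p.
Proof. by rewrite /form_value; case: insub => //=; rewrite mulr0 addr0. Qed.

Fact family_differential_linear (a : R) f g :
  family_differential (a *: f + g) =
  a *: family_differential f + family_differential g.
Proof.
apply: functional_extensionality_dep => L; apply/funext => p.
change (a * f L (val p).2 + g L (val p).2 - (a * f L (val p).1 + g L (val p).1)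
  = a * (f L (val p).2 - f L (val p).1) + (g L (val p).2 - g L (val p).1)).
by rewrite opprD addrACA -mulrBr.
Qed.

Fact colocal_function0 : colocal_function 0.
Proof.
split=> [L|L M LM]; first by apply: big1 => eta _; rewrite mul0r.
apply/funext => eta; rewrite /conditional_expectation big1 ?mulr0 //.
by move=> eta' _; rewrite mul0r.
Qed.

Fact colocal_functionP (a : R) f g :
  colocal_function f -> colocal_function g -> colocal_function (a *: f + g).
Proof.
move=> [f0 fP] [g0 gP]; split=> [L|L M LM].
  by rewrite expectation_linear f0 g0 mulr0 addr0.
by rewrite [LHS]conditional_expectation_linear fP gP.
Qed.

Definition C0_col : subspace function_families :=
  Subspace colocal_function0 colocal_functionP.

Fact colocal_closed_form0 : colocal_closed_form 0.
Proof.
have v0 L p : form_value (0 : form_space L) p = 0.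
  by rewrite /form_value; case: insub.
split=> [L|L M LM e _]; first split=> [p q _|eta s _ _].
- by rewrite oppr0.
- by apply: big1 => p _; exact: v0.
apply/funext => eta; rewrite /conditional_expectation /form_component v0.
by rewrite big1 ?mulr0 // => eta' _; rewrite v0 mul0r.
Qed.

Fact colocal_closed_formP (a : R) v w : colocal_closed_form v ->
  colocal_closed_form w -> colocal_closed_form (a *: v + w).
Proof.
move=> [v1 vP] [w1 wP]; split=> [L|L M LM e Ee]; first split=> [p q pq|eta s ps ls].
- change (a * v L q + w L q = - (a * v L p + w L p)).
  by rewrite ((v1 L).1 p q pq) ((w1 L).1 p q pq) mulrN opprD.
- have lin p : form_value ((a *: v + w) L) p =
    a * form_value (v L) p + form_value (w L) p by exact: form_value_linear.
  under eq_bigr do rewrite lin.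
  by rewrite big_split /= -mulr_sumr ((v1 L).2 _ _ ps ls) ((w1 L).2 _ _ ps ls) mulr0 addr0.
- have lin K e' : form_component ((a *: v + w) K) e' =
      a *: (form_component (v K) e' : function_space K) +
      (form_component (w K) e' : function_space K).
    by apply/funext => eta; exact: form_value_linear.
  by rewrite !lin [LHS]conditional_expectation_linear vP // wP.
Qed.

Definition Z1_col : subspace form_families :=
  Subspace colocal_closed_form0 colocal_closed_formP.

Fact cocycle0 : C0_col 0 /\ family_differential 0 = 0.
Proof.
split; first exact: carrier0.
apply: functional_extensionality_dep => L; apply/funext => p.
exact: subrr.
Qed.

Fact cocycleP (a : R) f g :
  C0_col f /\ family_differential f = 0 ->
  C0_col g /\ family_differential g = 0 ->
  C0_col (a *: f + g) /\ family_differential (a *: f + g) = 0.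
Proof.
move=> [f0 df] [g0 dg]; split; first exact: carrierP.
by rewrite family_differential_linear df dg scaler0 addr0.
Qed.

Definition H0_col : subspace function_families :=
  Subspace (carrier := fun f => C0_col f /\ family_differential f = 0)
    cocycle0 cocycleP.

End Colocal.

Arguments family_differential {R X S} E phi f.

Section DifferentialColocal.
Context (R : realType) (X : choiceType) (S : finType) (E : rel X).
Context (phi : S * S -> S * S) (nu : S -> R).
Implicit Types (L M : {fset X}).

Fact form_value_differential L (f : config L S -> R) (p : config L S * config L S) :
  (p.2 == p.1) || transition (@edge_in X E L) phi p.1 p.2 ->
  form_value (@differential R L S (@edge_in X E L) phi f) p = f p.2 - f p.1.
Proof.
rewrite /form_value; case: insubP => /= [q tq <- //|/negPf ->].
by rewrite orbF => /eqP ->; rewrite subrr.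
Qed.

Fact form_component_differential L (f : config L S -> R) (e : L * L) eta :
  edge_in E e.1 e.2 ->
  form_component (@differential R L S (@edge_in X E L) phi f) e eta =
  f (update phi eta e) - f eta.
Proof.
move=> Ee; rewrite [LHS]form_value_differential //=; case: eqP => //= /eqP ne.
by apply/existsP; exists e; rewrite Ee eqxx.
Qed.

Fact differential_closed L (f : config L S -> R) :
  is_closed_form (@differential R L S (@edge_in X E L) phi f).
Proof.
move=> eta s ps ls; apply: (@etrans _ _ (f (last eta s) - f eta)); last first.
  by rewrite ls subrr.
elim: s eta ps {ls} => [|z s IH] eta /=; first by rewrite big_nil subrr.
move=> /andP[tz ps]; rewrite big_cons IH // form_value_differential /= ?tz ?orbT //.
by rewrite addrC addrA subrK.
Qed.

(* eta inside L and eta' outside L *)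
Definition splice L M (eta : config L S) (eta' : config M S) : config M S :=
  [ffun y => if insub (val y) is Some x then eta x else eta' y].

Fact restriction_splice L M (LM : L `<=` M) (eta : config L S) eta' :
  restriction LM (splice eta eta' : config M S) = eta.
Proof.
apply/ffunP => x; rewrite !ffunE; case: insubP => [z _ zx|].
  by congr (eta _); exact: val_inj.
by rewrite (valP x).
Qed.

Fact spliceK L M (LM : L `<=` M) (eta eta1 : config L S) (eta' : config M S) :
  restriction LM eta' = eta -> splice eta (splice eta1 eta') = eta'.
Proof.
move=> <-; apply/ffunP => y; rewrite !ffunE; case: insubP => [x _ xy|//].
by rewrite ffunE; congr (eta' _); exact: val_inj.
Qed.

Fact update_splice L M (LM : L `<=` M) (eta' : config M S) (e : L * L) :
  update phi eta' (fincl LM e.1, fincl LM e.2) =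
  splice (update phi (restriction LM eta') e) eta'.
Proof.
apply/ffunP => y; rewrite !ffunE; case: insubP => [x _ xy|yL] /=.
  have -> : y = fincl LM x by exact: val_inj.
  by rewrite !ffunE !(inj_eq (@fincl_inj _ _ _ LM)).
have ny (x : L) : (y == fincl LM x) = false.
  by apply: contraNF yL => /eqP ->; exact: (valP x).
by rewrite !ny.
Qed.

Hypothesis nu_gt0 : forall s, 0 < nu s.

Fact product_measure_gt0 (Y : finType) (eta : config Y S) :
  0 < product_measure nu eta.
Proof. exact: prodr_gt0. Qed.

Fact product_measure_splice L M (LM : L `<=` M) (eta : config L S)
    (eta' : config M S) :
  product_measure nu (splice eta eta') * product_measure nu (restriction LM eta') =
  product_measure nu eta * product_measure nu eta'.
Proof.
have split_mu (z : config M S) : product_measure nu z =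
    product_measure nu (restriction LM z) *
    \prod_(y : M | val y \notin L) nu (z y).
  rewrite /product_measure (bigID (fun y : M => val y \in L)) /=; congr (_ * _).
  rewrite (eq_bigl [in fsub M L]); last by move=> y; rewrite in_fsub.
  rewrite (fsubE LM).
  rewrite big_imset /=; last by move=> x y _ _; exact: fincl_inj.
  by apply: eq_big => [x|x _]; rewrite ?inE ?ffunE.
rewrite split_mu restriction_splice [in RHS]split_mu mulrAC -!mulrA.
congr (_ * (_ * _)).
apply: eq_bigr => y yL; rewrite ffunE; case: insubP => // x.
by rewrite (negPf yL).
Qed.

Fact conditional_expectation_update L M (LM : L `<=` M) (f : config M S -> R)
    (e : L * L) :
  conditional_expectation nu LM
    (fun eta' => f (update phi eta' (fincl LM e.1, fincl LM e.2))) =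
  (fun eta => conditional_expectation nu LM f (update phi eta e)).
Proof.
apply/funext => eta; rewrite /conditional_expectation !mulr_sumr.
rewrite [RHS](reindex_onto (splice (update phi eta e)) (splice eta)); last first.
  by move=> z /eqP; exact: spliceK.
apply: eq_big => [z|z /eqP rz].
  rewrite restriction_splice eqxx /=; apply/eqP/eqP => [rz|<-].
    by rewrite (spliceK _ rz).
  by rewrite restriction_splice.
rewrite update_splice rz; set u := update _ _ _.
rewrite mulrCA [RHS]mulrCA; congr (_ * _).
have := product_measure_splice LM u z; rewrite rz => muE.
have [m0 m1] := (lt0r_neq0 (product_measure_gt0 eta), lt0r_neq0 (product_measure_gt0 u)).
by rewrite -[product_measure nu z](mulKf m1) -muE mulrCA [_ * product_measure nu eta]mulrC mulKf.
Qed.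

Fact colocal_differential (f : function_families R X S) :
  colocal_function nu f -> colocal_closed_form nu (family_differential E phi f).
Proof.
move=> [_ fP]; split=> [L|L M LM e Ee].
  split=> [p q pq|]; last exact: differential_closed.
  by rewrite /family_differential /differential pq /= opprB.
have -> : form_component (family_differential E phi f M)
    (fincl LM e.1, fincl LM e.2) =
  -1 *: (f M : function_space R S M) +
  (fun eta => f M (update phi eta (fincl LM e.1, fincl LM e.2))).
  apply/funext => eta; rewrite [LHS]form_component_differential //.
  by rewrite addrC -[- f M eta]scaleN1r.
rewrite conditional_expectation_linear conditional_expectation_update fP.
apply/funext => eta; rewrite [RHS]form_component_differential //.
by rewrite addrC -[- f L eta]scaleN1r.
Qed.

End DifferentialColocal.

Record locale_action (G : groupType) (X : Type) (E : rel X) := LocaleAction {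
  action :> G -> X -> X;
  action1 : forall x, action 1%g x = x;
  actionM : forall s t x, action (s * t)%g x = action s (action t x);
  action_edge : forall s x y, E (action s x) (action s y) = E x y
}.

Definition free_action (G : groupType) (X : Type) (E : rel X)
    (A : locale_action G E) : Prop :=
  forall s x, A s x = x -> s = 1%g.

Section Action.
Context (R : realType) (X : choiceType) (S : finType) (E : rel X).
Context (phi : S * S -> S * S) (nu : S -> R).
Context (G : groupType) (A : locale_action G E).
Implicit Types (s : G) (L : {fset X}).

Definition translate s L : {fset X} := [fset A s x | x in L].

Fact translate_preimage s L (x : translate s L) : A s^-1%g (val x) \in L.
Proof.
have /imfsetP[/= y yL ->] := valP x.
by rewrite -actionM mulVg action1.
Qed.

Definition translate_config s L (eta : config L S) :
    config (translate s L) S :=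
  [ffun x => eta [` translate_preimage x]].

(* The component at L of the translate of f by s is the translate of the
   component of f at the preimage of L. *)
Definition translate_function s (f : function_families R X S) :
    function_families R X S :=
  fun L eta => f (translate s^-1%g L) (translate_config s^-1%g eta).

Definition translate_form s (w : form_families R E phi) :
    form_families R E phi :=
  fun L p => form_value (w (translate s^-1%g L))
    (translate_config s^-1%g (val p).1, translate_config s^-1%g (val p).2).

Fact translate_function_linear s (a : R) f g :
  translate_function s (a *: f + g) =
  a *: translate_function s f + translate_function s g.
Proof. by []. Qed.

Fact translate_form_linear s (a : R) v w :
  translate_form s (a *: v + w) = a *: translate_form s v + translate_form s w.
Proof.
apply: functional_extensionality_dep => L; apply/funext => p.
exact: form_value_linear.
Qed.

Fact translate_transition s L (eta eta' : config L S) :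
  transition (@edge_in X E L) phi eta eta' ->
  transition (@edge_in X E _) phi (translate_config s eta) (translate_config s eta').
Proof.
move=> /existsP[e /and3P[Ee /eqP eta'E ne]].
have sP (x : L) : A s (val x) \in translate s L by rewrite in_imfset //= valP.
pose g (x : L) : translate s L := [` sP x].
have gK (x : L) (p : A s^-1%g (val (g x)) \in L) : [` p] = x.
  by apply: val_inj; rewrite /= -actionM mulVg action1.
have hK (y : translate s L) : g [` translate_preimage y] = y.
  by apply: val_inj; rewrite /= -actionM mulgV action1.
apply/existsP; exists (g e.1, g e.2); apply/and3P; split.
- by rewrite /edge_in /= action_edge.
- apply/eqP/ffunP => y; rewrite eta'E !ffunE /= !gK.
  have ge (x : L) : (y == g x) = ([` translate_preimage y] == x).
    by apply/eqP/eqP => [->|<-]; rewrite ?gK ?hK.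
  by rewrite !ge.
- apply: contraNneq ne => /ffunP tE; apply/eqP/ffunP => x.
  by have := tE (g x); rewrite !ffunE !gK.
Qed.

Fact translate_differential s (f : function_families R X S) :
  translate_form s (family_differential E phi f) =
  family_differential E phi (translate_function s f).
Proof.
apply: functional_extensionality_dep => L; apply/funext => p.
by rewrite [LHS]form_value_differential // (translate_transition _ (valP p)) orbT.
Qed.

Fact invariant_function0 :
  C0_col X nu 0 /\ forall s, translate_function s 0 = 0.
Proof. by split=> [|s]; [exact: carrier0|]. Qed.

Fact invariant_functionP (a : R) f g :
  C0_col X nu f /\ (forall s, translate_function s f = f) ->
  C0_col X nu g /\ (forall s, translate_function s g = g) ->
  C0_col X nu (a *: f + g) /\
    (forall s, translate_function s (a *: f + g) = a *: f + g).
Proof.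
move=> [f0 Gf] [g0 Gg]; split=> [|s]; first exact: carrierP.
by rewrite translate_function_linear Gf Gg.
Qed.

Definition C0_col_inv : subspace (function_families R X S) :=
  Subspace (carrier := fun f =>
      C0_col X nu f /\ forall s, translate_function s f = f)
    invariant_function0 invariant_functionP.

Fact invariant_form0 :
  Z1_col E phi nu 0 /\ forall s, translate_form s (0 : form_families R E phi) = 0.
Proof.
split=> [|s]; first exact: carrier0.
by have := translate_form_linear s (-1) 0 0; rewrite !scaleN1r !addNr.
Qed.

Fact invariant_formP (a : R) v w :
  Z1_col E phi nu v /\ (forall s, translate_form s v = v) ->
  Z1_col E phi nu w /\ (forall s, translate_form s w = w) ->
  Z1_col E phi nu (a *: v + w) /\
    (forall s, translate_form s (a *: v + w) = a *: v + w).
Proof.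
move=> [v0 Gv] [w0 Gw]; split=> [|s]; first exact: carrierP.
by rewrite translate_form_linear Gv Gw.
Qed.

Definition Z1_col_inv : subspace (form_families R E phi) :=
  Subspace (carrier := fun w =>
      Z1_col E phi nu w /\ forall s, translate_form s w = w)
    invariant_form0 invariant_formP.

Fact invariant_differential (f : function_families R X S) :
  (forall x : S, 0 < nu x) -> C0_col_inv f -> Z1_col_inv (family_differential E phi f).
Proof.
move=> nu_gt0 [f0 Gf]; split=> [|s]; first exact: colocal_differential.
by rewrite translate_differential Gf.
Qed.

Definition exact_form (w : Z1_col_inv) : Prop :=
  exists2 f, C0_col_inv f & family_differential E phi f = val w.

Fact exact_form0 : exact_form 0.
Proof.
exists 0; first exact: carrier0.
by rewrite -[0 in LHS](addNr 0) -scaleN1r family_differential_linear scaleN1r addNr.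
Qed.

Fact exact_formP (a : R) (v w : Z1_col_inv) :
  exact_form v -> exact_form w -> exact_form (a *: v + w).
Proof.
move=> [f Cf df] [g Cg dg]; exists (a *: f + g); first exact: carrierP.
by rewrite family_differential_linear df dg.
Qed.

(* By invariant_differential, this is the whole image of C0_col_inv under the
   differential, seen inside Z1_col_inv. *)
Definition B1_col_inv : subspace Z1_col_inv :=
  Subspace exact_form0 exact_formP.

Definition group_hom (h : G -> H0_col E phi nu) : Prop :=
  forall s t, h (s * t)%g = h s + h t.

Fact group_hom0 : group_hom 0.
Proof. by move=> s t; exact: (esym (addr0 0)). Qed.

Fact group_homP (a : R) (h k : G -> H0_col E phi nu) :
  group_hom h -> group_hom k -> group_hom (a *: h + k).
Proof.
move=> Hh Hk s t.
change (a *: h (s * t)%g + k (s * t)%g = a *: h s + k s + (a *: h t + k t)).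
by rewrite Hh Hk scalerDr addrACA.
Qed.

Definition Hom_Z : subspace (G -> H0_col E phi nu) :=
  Subspace group_hom0 group_homP.

End Action.

(* Main.v *)
(* Two facts about C0_col give the theorem.

   The differential is onto Z1_col.  Pairing with the measure identifies
   co-local functions with linear functionals on local functions (functions of
   finitely many coordinates).  A closed form w prescribes such a functional on
   a subspace, consistently because w has a primitive on every finite set, and
   any linear extension of it is a co-local primitive of w.

   The coboundary map of G kills H^1(G, H0_col) inside C0_col.  Irreducible
   quantification makes f in H0_col depend only on the multiset of values of a
   configuration, so G acts trivially on H0_col.  A homomorphism h from G to
   H0_col is then a cocycle; decompose co-local functions into pure components
   indexed by finite subsets B of X (Moebius inversion), share the component on
   B equally between the points of B, and twist the share of x by h (t x), where
   t is G-equivariant from X to G.  The sum f satisfies f - s f = h s.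

   Consequently h |-> d f is a linear section of Z1_col^G over Hom(G, H0_col)
   whose image is a complement of the space of exact forms. *)

Require Import Defs.
From HB Require Import structures.
From mathcomp Require Import all_boot all_order all_algebra finmap.
From mathcomp Require Import generic_quotient.
From mathcomp Require Import boolp classical_sets functions cardinality reals.

Set Implicit Arguments.
Unset Strict Implicit.
Unset Printing Implicit Defensive.

Import Order.TTheory GRing.Theory Num.Theory.

Local Open Scope ring_scope.

(** * Extension of linear functionals by Zorn's lemma *)

Section LinearAlgebra.
Context (R : fieldType).

Lemma linear_map_exists (V W : lmodType R) (f : V -> W) :
  (forall a u v, f (a *: u + v) = a *: f u + f v) ->
  exists g : {linear V -> W}, forall v, g v = f v.
Proof.
move=> lf.
pose m := GRing.isLinear.Build R V W *:%R f lf.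
pose g : {linear V -> W} := HB.pack f m.
by exists g.
Qed.

Lemma inj_surj_bijective (T U : Type) (f : T -> U) :
  injective f -> (forall y, exists x, f x = y) -> bijective f.
Proof.
move=> fI fS; pose g y := projT1 (cid (fS y)).
have gK : cancel g f by move=> y; rewrite /g; case: cid.
by exists g => // x; apply: fI; rewrite gK.
Qed.

(** A functional on a subspace is encoded by its graph, so that extension is inclusion and unions of
    chains make sense. By linearity the last clause amounts to single-valuedness. *)
Definition linear_graph (V : lmodType R) (P : set (V * R)) : Prop :=
  [/\ P (0, 0),
      forall a u r v s, P (u, r) -> P (v, s) -> P (a *: u + v, a * r + s)
    & forall r, P (0, r) -> r = 0].

Lemma linear_graph_fun (V : lmodType R) (P : set (V * R)) v r s :
  linear_graph P -> P (v, r) -> P (v, s) -> r = s.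
Proof.
move=> [_ PD P0] Pr Ps; have := PD (-1) _ _ _ _ Ps Pr.
by rewrite scaleN1r addNr mulN1r addrC => /P0 /eqP; rewrite subr_eq0 => /eqP.
Qed.

(** A vector outside the domain may receive any value, here 0. A second value at 0 would come from a
    nonzero multiple of [v], and rescaling would put [v] in the domain. *)
Lemma linear_graph_extend (V : lmodType R) (P : set (V * R)) (v : V) :
  linear_graph P -> (forall r, ~ P (v, r)) ->
  exists Q : set (V * R), [/\ linear_graph Q, (P `<=` Q)%classic & Q (v, 0)].
Proof.
move=> [P0 PD PF] Pv.
exists [set q | exists a, P (q.1 - a *: v, q.2)]%classic; split=> [|[u r] Pu|] /=.
- split=> [|a u r w s [b Pb] [c Pc]|r [a Pa]] /=.
  + by exists 0; rewrite scale0r subr0.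
  + exists (a * b + c); have := PD a _ _ _ _ Pb Pc.
    by rewrite scalerBr scalerA scalerDl opprD addrACA.
  + move: Pa; rewrite sub0r; have [->|a0] := eqVneq a 0.
      by rewrite scale0r oppr0 => /PF.
    move=> Pa; exfalso; have := PD (- a^-1) _ _ _ _ Pa P0.
    rewrite addr0 scalerN scaleNr opprK scalerA mulVf // scale1r.
    exact: Pv.
- by exists 0; rewrite scale0r subr0.
- by exists 1; rewrite scale1r subrr.
Qed.

Lemma linear_graph_total (V : lmodType R) (P : set (V * R)) :
  linear_graph P ->
  exists l : V -> R, (forall a u v, l (a *: u + v) = a * l u + l v) /\
    forall v r, P (v, r) -> l v = r.
Proof.
move=> gP.
(* Zorn's lemma is applied to the sets whose union with [P] is a linear graph, so that the empty
   chain is bounded too. *)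
have [F totF Fgr|A [gA maxA]] :=
    @Zorn_bigcup _ (fun A => linear_graph (P `|` A)%classic).
  have [P0 PD PF] := gP.
  (* Any two pairs already lie in one linear graph below the union, where the closure conditions can
     be checked. *)
  have pair p q : (P `|` \bigcup_(B in F) B)%classic p ->
      (P `|` \bigcup_(B in F) B)%classic q ->
      exists C, [/\ linear_graph C, C p, C q &
        (C `<=` P `|` \bigcup_(B in F) B)%classic].
    have sub B : F B -> (P `|` B `<=` P `|` \bigcup_(B in F) B)%classic.
      by move=> FB x [Px|Bx]; [left|right; exists B].
    case=> [Pp|[B FB Bp]] [Pq|[C FC Cq]].
    - by exists P; split=> // x; left.
    - by exists (P `|` C)%classic; split; [exact: totF|left|right|exact: sub].
    - by exists (P `|` B)%classic; split; [exact: totF|right|left|exact: sub].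
    - have [BC|CB] := Fgr _ _ FB FC.
      + by exists (P `|` C)%classic; split;
          [exact: totF|right; exact: BC|right|exact: sub].
      + by exists (P `|` B)%classic; split;
          [exact: totF|right|right; exact: CB|exact: sub].
  split=> [|a u r v s Pu Pv|r Pr]; first by left.
  - have [C [[_ CD _] Cu Cv sC]] := pair _ _ Pu Pv.
    by apply: sC; exact: CD.
  - have [C [[_ _ CF] Cr _ _]] := pair _ _ Pr Pr.
    exact: CF.
have tot v : exists r, (P `|` A)%classic (v, r).
  apply: contrapT => /forallNP nv.
  have [Q [gQ sQ Qv]] := linear_graph_extend gA nv.
  apply: (maxA Q).
    split=> [x Ax|QA]; first by apply: sQ; right.
    by apply: (nv 0); right; apply: QA.
  suff -> : (P `|` Q)%classic = Q by [].
  by apply/seteqP; split=> [x [Px|//]|x Qx]; [apply: sQ; left|right].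
pose l v := projT1 (cid (tot v)).
have lP v : (P `|` A)%classic (v, l v) by rewrite /l; case: cid.
exists l; split=> [a u v|v r Pv].
  have [_ AD _] := gA.
  exact: linear_graph_fun gA (lP _) (AD _ _ _ _ _ (lP u) (lP v)).
by apply: linear_graph_fun gA (lP v) _; left.
Qed.

End LinearAlgebra.

(** * Quotient and direct sum given by a linear complement *)

Section Splitting.
Local Open Scope quotient_scope.
Context (R : fieldType) (V W : lmodType R) (U : subspace V).
Context (sg : {linear W -> V}).
Hypothesis sg_surj : forall v, exists w, U (v - sg w).
Hypothesis sg_inj : forall w, U (sg w) -> w = 0.

(** The hypotheses make [sg] injective with image a complement of [U]. Each class thus contains
    [sg w] for exactly one [w], and uniqueness makes the choice of [w] linear. *)
Lemma isomorphic_quotient_section : isomorphic (quotient_space U) W.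
Proof.
pose Q := quotient_space U.
have piE (u v : V) : (\pi_Q u = \pi_Q v) <-> U (u - v).
  split=> [/eqP|Uuv]; first by rewrite -Quotient.idealrBE => /asboolP.
  by apply/eqP; rewrite -Quotient.idealrBE; apply/asboolP.
have U0 : U 0 by exact: carrier0.
have ex (q : Q) : exists w, U (repr q - sg w) by exact: sg_surj.
pose p q := projT1 (cid (ex q)).
have pP q : \pi_Q (sg (p q)) = q.
  by rewrite -[RHS]reprK; apply/esym/piE; rewrite /p; case: cid.
have pK w q : \pi_Q (sg w) = q -> p q = w.
  rewrite -{1}(pP q) => /piE; rewrite -raddfB => /sg_inj /eqP.
  by rewrite subr_eq0 => /eqP ->.
have [|f fE] := @linear_map_exists R Q W p.
  move=> a u v; apply: pK; rewrite linearP /=.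
  rewrite (pi_quotient_add U) (pi_quotient_scale U).
  by rewrite !pP.
exists f; apply: inj_surj_bijective => [u v|w].
  by rewrite !fE => e; rewrite -(pP u) e pP.
by exists (\pi_Q (sg w)); rewrite fE; exact: pK.
Qed.

Lemma splitting_section (W' : lmodType R) (t : {linear W' -> W}) :
  bijective t ->
  exists f : {linear (U * W')%type -> V},
    bijective f /\ forall b, f (b, 0) = val b.
Proof.
move=> [t' tK t'K].
have UD a u v : U u -> U v -> U (a *: u + v) by exact: carrierP.
have UP (u : U) : U (val u) by exact/asboolP/(valP u).
have [|f fE] := @linear_map_exists R _ V
    (fun q : (U * W')%type => val q.1 + sg (t q.2)).
  move=> a u v /=; rewrite !linearP /= scalerDr addrACA.
  by [].
exists f; split; last by move=> b; rewrite fE /= !linear0 addr0.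
apply: inj_surj_bijective => [[u w] [u' w']|v].
  rewrite !fE /= => e.
  have ww : w = w'.
    apply: (can_inj tK); apply/eqP; rewrite -subr_eq0; apply/eqP/sg_inj.
    rewrite raddfB /=.
    have -> : sg (t w) - sg (t w') = -1 *: val u + val u'.
      by rewrite scaleN1r; apply/eqP; rewrite subr_eq -addrA -e addKr.
    exact: UD.
  by move: e; rewrite ww => /addIr/val_inj ->.
have [w Uw] := sg_surj v.
have Uw' : v - sg w \in mem_subspace U by apply/asboolP.
by exists (Sub (v - sg w) Uw', t' w); rewrite fE /= t'K subrK.
Qed.

End Splitting.

(** * Coordinates on an abelian group of finite rank *)

Section RankCoordinates.
Context (R : numFieldType).

(** Adjoining [a] to [b] gives d + 1 elements, hence a nontrivial relation. Its coefficient at [a]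
    is nonzero, since otherwise it would be a relation among the [b i]. *)
Lemma torsion_over_independent (A : zmodType) (d : nat) (b : 'I_d -> A) (a : A) :
  has_rank A d -> Z_independent b ->
  exists (n : int) (c : 'I_d -> int), n != 0 /\ a *~ n = \sum_i b i *~ c i.
Proof.
move=> [_ maxd] ib.
pose b' (i : 'I_d.+1) := oapp b a (unlift ord_max i).
have /existsNP[c /not_implyP[c0 /existsNP[i ci]]] : ~ Z_independent b'.
  by move=> /maxd; rewrite ltnn.
have sE : \sum_j b j *~ c (lift ord_max j) = a *~ - c ord_max.
  move: c0; rewrite (bigD1_ord ord_max) //= /b' unlift_none /=.
  under eq_bigr do rewrite liftK /=.
  by move=> /eqP; rewrite addrC addr_eq0 => /eqP ->; rewrite mulrNz.
have [cm|cm] := eqVneq (c ord_max) 0; last first.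
  by exists (- c ord_max), (fun j => c (lift ord_max j)); rewrite oppr_eq0.
case: ci; case: (unliftP ord_max i) => [j|] -> //.
by apply: (ib (fun j => c (lift ord_max j))); rewrite sE cm oppr0.
Qed.

(** From n a = sum of c_i b_i the coordinates are c_i / n, those of [a] in the tensor product of [A]
    with the field. An additive map to a vector space respects them because n can be divided out in
    the target. *)
Lemma rank_coordinates (A : zmodType) (d : nat) :
  has_rank A d ->
  exists (b : 'I_d -> A) (r : A -> 'I_d -> R),
    [/\ forall a a' i, r (a + a') i = r a i + r a' i,
        forall i j, r (b j) i = (i == j)%:R
      & forall (V : lmodType R) (h : A -> V),
          {morph h : a a' / a + a'} ->
          forall a, h a = \sum_i r a i *: h (b i)].
Proof.
move=> rk; have [[b ib] _] := rk.
have ex a : exists nc : int * ('I_d -> int),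
    nc.1 != 0 /\ a *~ nc.1 = \sum_i b i *~ nc.2 i.
  by have [n [c nc]] := torsion_over_independent a rk ib; exists (n, c).
pose n a := (projT1 (cid (ex a))).1; pose c a := (projT1 (cid (ex a))).2.
have n0 a : n a != 0 by rewrite /n; case: cid => ? [].
have nc a : a *~ n a = \sum_i b i *~ c a i by rewrite /n /c; case: cid => ? [].
pose r a i : R := (c a i)%:~R / (n a)%:~R.
have nR0 a : (n a)%:~R != 0 :> R by rewrite intr_eq0.
have uniq a m k i : m != 0 -> a *~ m = \sum_i b i *~ k i ->
    r a i = (k i)%:~R / m%:~R.
  move=> m0 am.
  have mR0 : m%:~R != 0 :> R by rewrite intr_eq0.
  suff e : c a i * m = k i * n a.
    by apply/eqP; rewrite eqr_div // -!intrM e.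
  (* Cross-multiplying two relations for [a] eliminates [a] and leaves a relation among the
     independent [b j]. *)
  apply/eqP; rewrite -subr_eq0; apply/eqP.
  apply: (ib (fun j => c a j * m - k j * n a)).
  have -> : \sum_j b j *~ (c a j * m - k j * n a) =
      (\sum_j b j *~ c a j) *~ m - (\sum_j b j *~ k j) *~ n a.
    rewrite !mulrz_suml -sumrB; apply: eq_bigr => j _.
    by rewrite mulrzBr !mulrzA.
  by rewrite -am -nc -!mulrzA mulrC subrr.
exists b, r; split=> [a a' i|i j|V h hD a].
- rewrite (@uniq _ (n a * n a') (fun i => c a i * n a' + c a' i * n a)).
  + by rewrite rmorphD !rmorphM /= addf_div.
  + by rewrite mulf_neq0.
  + rewrite mulrzDl mulrzA nc [n a * n a']mulrC mulrzA nc !mulrz_suml -big_split.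
    by apply: eq_bigr => j _; rewrite /= mulrzDr !mulrzA.
- rewrite (@uniq _ 1 (fun i => (i == j)%:R)) ?oner_neq0 //.
    by rewrite divr1; case: eqP.
  rewrite (bigD1 j) //= eqxx big1 ?addr0 // => k /negPf ->.
  by rewrite mulr0z.
have h0 : h 0 = 0 by apply: (addIr (h 0)); rewrite -hD !add0r.
have hN x : h (- x) = - h x by apply/eqP; rewrite -addr_eq0 -hD addNr h0.
have hn x (m : nat) : h (x *+ m) = h x *+ m.
  by elim: m => [|m IH]; rewrite ?mulr0n // !mulrS hD IH.
have hz x (m : int) : h (x *~ m) = h x *~ m.
  by case: m => m; rewrite ?NegzE ?mulrNz ?hN -?pmulrn hn.
apply: (scalerI (nR0 a)); rewrite scaler_int -hz nc.
have hs (s : seq 'I_d) F : h (\sum_(i <- s) F i) = \sum_(i <- s) h (F i).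
  by elim/big_rec2: _ => // i y1 y2 _ <-.
rewrite hs scaler_sumr; apply: eq_bigr => i _.
by rewrite hz scalerA mulrC divfK // scaler_int.
Qed.

End RankCoordinates.

(** * Homomorphisms to [H0_col] as d-tuples *)

Section HomCoordinates.
Local Open Scope quotient_scope.
Context (R : realType) (X : choiceType) (S : finType) (E : rel X).
Context (phi : S * S -> S * S) (nu : S -> R) (G : groupType).

Lemma group_hom_abelianization (h : G -> H0_col E phi nu) x y :
  group_hom h -> \pi_(abelianization G) x = \pi_(abelianization G) y -> h x = h y.
Proof.
move=> hM /eqP/ab_eqP xy.
have h1 : h 1%g = 0 by apply: (addIr (h 1%g)); rewrite -hM mulg1 add0r.
have hV u : h u^-1%g = - h u by apply/eqP; rewrite -addr_eq0 -hM mulVg h1.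
have comm0 u : commutator_subgroup u -> h u = 0.
  elim=> {u} [u v|//|u v _ hu _ hv|u _ hu].
  - by rewrite /commg /conjg !hM !hV (addrC (h u)) addKr addNr.
  - by rewrite hM hu hv addr0.
  - by rewrite hV hu oppr0.
by apply/eqP; rewrite eq_sym -subr_eq0 addrC -hV -hM comm0.
Qed.

(** A homomorphism to a real vector space factors through the abelianization and is fixed by its
    values at the [b i]. The coordinates [r] realize every tuple of values. *)
Lemma Hom_coordinates (d : nat) : has_rank (abelianization G) d ->
  exists t : {linear ('I_d -> H0_col E phi nu) -> Hom_Z E phi nu G}, bijective t.
Proof.
move=> /(rank_coordinates R)[b [r [rD rb rP]]].
pose A := abelianization G.
pose t (v : 'I_d -> H0_col E phi nu) (x : G) := \sum_i r (\pi_A x) i *: v i.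
have tP v : t v \in mem_subspace (Hom_Z E phi nu G).
  apply/asboolP => x y; rewrite /t -big_split; apply: eq_bigr => i _ /=.
  rewrite -scalerDl -rD; congr (r _ i *: _).
  by rewrite -(ab_addE x y).
have [|f fE] := @linear_map_exists R _ (Hom_Z E phi nu G) (fun v => Sub (t v) (tP v)).
  move=> a u v; apply: val_inj; apply/funext => x.
  transitivity (a *: t u x + t v x); last by [].
  rewrite /= /t scaler_sumr -big_split; apply: eq_bigr => i _ /=.
  by rewrite scalerDr !scalerA mulrC.
exists f; apply: inj_surj_bijective => [u v|h].
  rewrite !fE => /(congr1 val) /= tuv; apply/funext => i.
  have := congr1 (fun k => k (repr (b i))) tuv; rewrite /t reprK.
  have sE (w : 'I_d -> H0_col E phi nu) : \sum_j r (b i) j *: w j = w i.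
    rewrite (bigD1 i) //= rb eqxx scale1r big1 ?addr0 // => j /negPf ji.
    by rewrite rb ji scale0r.
  by rewrite !sE.
have hM : group_hom (val h) by exact/asboolP/(valP h).
exists (fun i => val h (repr (b i))); rewrite fE; apply: val_inj => /=.
apply/funext => x; rewrite /t.
rewrite -(rP _ (fun a => val h (repr a))).
  by apply: group_hom_abelianization => //; rewrite reprK.
move=> a a'; rewrite -hM; apply: group_hom_abelianization => //.
by rewrite reprK.
Qed.

End HomCoordinates.

(** * Primitives of closed forms on a finite configuration space *)

Section Primitive.
Context (R : realType) (Y S : finType) (F : rel Y) (phi : S * S -> S * S).
Implicit Types (eta : config Y S).

(** The interaction identity says that a transition along (a, b) is undone by the reversed edge (b,
    a). *)
Lemma transition_sym : symmetric F -> irreflexive F -> is_interaction phi ->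
  symmetric (transition F phi : rel (config Y S)).
Proof.
move=> symF irrF phiI.
suff imp eta eta' : transition F phi eta eta' -> transition F phi eta' eta.
  by move=> eta eta'; apply/idP/idP; exact: imp.
move=> /existsP[[a b] /= /and3P[Fab /eqP eta'E ne]].
(* The endpoints must differ for [update] to write both components of [phi]. *)
have ba : (b == a) = false by apply: contraTF Fab => /eqP ->; rewrite irrF.
have ab : (a == b) = false by rewrite eq_sym.
have pE : phi (eta a, eta b) = (eta' a, eta' b).
  by rewrite eta'E !ffunE /= ba !eqxx; case: (phi _).
have ps : phi (eta a, eta b) != (eta a, eta b).
  apply: contra ne; rewrite pE => /eqP[ea eb]; apply/eqP/ffunP => z.
  rewrite {1}eta'E ffunE /=; case: eqP => [->|_]; first by rewrite pE.
  by case: eqP => [->|//]; rewrite pE.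
have := phiI _ ps; rewrite pE /swap_pair /= => [[e1 e2]].
apply/existsP; exists (b, a); rewrite /= symF Fab (eq_sym eta eta') ne andbT /=.
apply/eqP/ffunP => z; rewrite ffunE /= e1 e2; case: eqP => [->//|/eqP/negPf zb].
by case: eqP => [->//|/eqP/negPf za]; rewrite eta'E ffunE /= za zb.
Qed.

Section PathSum.
Context (w : transitions F phi -> R).

Definition path_sum eta (s : seq (config Y S)) : R :=
  \sum_(p <- zip (eta :: s) s) form_value w p.

Lemma path_sum_cat eta s t :
  path_sum eta (s ++ t) = path_sum eta s + path_sum (last eta s) t.
Proof.
rewrite /path_sum; elim: s eta => [|a s IH] eta /=; first by rewrite big_nil add0r.
by rewrite !big_cons IH addrA.
Qed.

Hypothesis tr_sym : symmetric (transition F phi : rel (config Y S)).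

(** The form is integrated along paths from a chosen root of each connected component. Two paths
    with common ends, closed by the same return path, have equal sums. *)
Lemma closed_form_primitive : is_closed_form w ->
  exists f : config Y S -> R, differential f = w.
Proof.
move=> closed_w; pose T : rel (config Y S) := transition F phi.
have T_sym : connect_sym T by exact: sym_connect_sym.
have indep eta s t : path T eta s -> path T eta t -> last eta s = last eta t ->
    path_sum eta s = path_sum eta t.
  move=> ps pt lst.
  have /connectP[c pc lc] : connect T (last eta s) eta.
    rewrite T_sym; apply/connectP; by exists s.
  have := closed_w eta (s ++ c); have := closed_w eta (t ++ c).
  rewrite !cat_path !last_cat -lst ps pt pc -lc => /(_ isT erefl) tc /(_ isT erefl) sc.
  move: sc; rewrite -[LHS]/(path_sum _ _) path_sum_cat.
  by move: tc; rewrite -[LHS]/(path_sum _ _) path_sum_cat lst => <- /addIr.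
have ex eta : exists s,
    path T (fingraph.root T eta) s && (last (fingraph.root T eta) s == eta).
  have : connect T (fingraph.root T eta) eta.
    by rewrite T_sym connect_root.
  by move=> /connectP[s ps e]; exists s; rewrite ps -e eqxx.
pose s eta := projT1 (cid (ex eta)).
have sp eta : path T (fingraph.root T eta) (s eta) by rewrite /s; case: cid => ? /= /andP[].
have sl eta : last (fingraph.root T eta) (s eta) = eta.
  by rewrite /s; case: cid => ? /= /andP[_ /eqP].
exists (fun eta => path_sum (fingraph.root T eta) (s eta)).
apply/funext => -[[a b] /= Tab]; rewrite /differential /=.
have rab : fingraph.root T b = fingraph.root T a.
  by apply/esym/eqP; rewrite (root_connect T_sym) connect1.
have -> : path_sum (fingraph.root T b) (s b) = path_sum (fingraph.root T a) (s a ++ [:: b]).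
  rewrite rab; apply: indep; first by rewrite -rab.
    by rewrite cat_path sp sl /= andbT; exact: Tab.
  by rewrite -[in LHS]rab sl last_cat.
rewrite path_sum_cat addrC addKr sl /path_sum /= big_seq1 /form_value.
by case: insubP => [u Tu uE|]; [congr w; exact: val_inj|move=> /negP[]].
Qed.

End PathSum.

End Primitive.

(** * Primitives of mean zero *)

Section ProductMeasure.
Context (R : realType) (Y S : finType) (nu : S -> R).
Hypothesis nu_sum1 : \sum_s nu s = 1.

Lemma product_measure_sum1 : \sum_(eta : config Y S) product_measure nu eta = 1.
Proof.
rewrite /product_measure -(bigA_distr_bigA (fun (_ : Y) s => nu s)) /=.
by rewrite big1.
Qed.

Lemma closed_form_primitive0 (F : rel Y) (phi : S * S -> S * S)
    (w : transitions F phi -> R) :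
  symmetric F -> irreflexive F -> is_interaction phi -> is_closed_form w ->
  exists2 f : config Y S -> R, differential f = w & expectation nu f = 0.
Proof.
move=> sF iF phiI /(closed_form_primitive (transition_sym sF iF phiI))[f df].
exists (fun eta => f eta - expectation nu f).
  by rewrite -df; apply/funext => p; rewrite /differential opprB addrA addrNK.
rewrite {1}/expectation; under eq_bigr do rewrite mulrBl.
by rewrite big_split /= sumrN -mulr_sumr product_measure_sum1 mulr1 subrr.
Qed.

End ProductMeasure.

(** * Co-local functions on total configurations and one-point averages *)

Section TotalConfigurations.
Local Open Scope fset_scope.
Local Open Scope ring_scope.
Context (R : realType) (X : choiceType) (S : finType) (nu : S -> R).
Implicit Types (L M A B C : {fset X}) (z : X -> S) (f g : function_families R X S).

Definition restrict L z : config L S := [ffun x => z (val x)].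

(** Reading every component on total configurations makes components at different finite sets
    comparable without dependent types. *)
Definition eval f L z : R := f L (restrict L z).

Definition set_at z (y : X) (s : S) : X -> S := fun x => if x == y then s else z x.

(** This is the operator that integrates out the coordinate [y]. *)
Definition average (y : X) (F : (X -> S) -> R) z : R :=
  \sum_s nu s * F (set_at z y s).

Lemma eq_restrict L z z' : {in L, z =1 z'} -> restrict L z = restrict L z'.
Proof. by move=> zz; apply/ffunP => x; rewrite !ffunE zz // (valP x). Qed.

Lemma eq_eval f L z z' : {in L, z =1 z'} -> eval f L z = eval f L z'.
Proof. by move=> /eq_restrict zz; rewrite /eval zz. Qed.

Lemma eval_linear a f g L z :
  eval (a *: f + g) L z = a * eval f L z + eval g L z.
Proof. by []. Qed.

Lemma restriction_restrict L M (LM : L `<=` M) z :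
  restriction LM (restrict M z) = restrict L z.
Proof. by apply/ffunP => x; rewrite !ffunE. Qed.

Lemma restrict_surj (s0 : S) L (eta : config L S) : exists z, restrict L z = eta.
Proof.
exists (fun x => oapp eta s0 (insub x)); apply/ffunP => x.
by rewrite ffunE valK.
Qed.

Lemma eval_inj (s0 : S) f g :
  (forall L z, eval f L z = eval g L z) -> f = g.
Proof.
move=> fg; apply: functional_extensionality_dep => L; apply/funext => eta.
by have [z <-] := restrict_surj s0 eta; exact: fg.
Qed.

Lemma product_measure_restrict L z :
  product_measure nu (restrict L z) = \prod_(x <- L) nu (z x).
Proof.
rewrite big_seq_fsetE /=; apply: eq_bigr => x _.
by rewrite ffunE.
Qed.

Lemma average_linear y a F G z :
  average y (fun z => a * F z + G z) z = a * average y F z + average y G z.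
Proof.
rewrite /average mulr_sumr -big_split; apply: eq_bigr => s _.
by rewrite mulrDr mulrCA.
Qed.

Lemma average_sum (I : Type) (r : seq I) (P : pred I) y (F : I -> (X -> S) -> R) z :
  average y (fun z => \sum_(i <- r | P i) F i z) z =
  \sum_(i <- r | P i) average y (F i) z.
Proof.
rewrite /average exchange_big; apply: eq_bigr => s _ /=.
by rewrite mulr_sumr.
Qed.

Lemma eq_average y F G z : F =1 G -> average y F z = average y G z.
Proof. by move=> FG; apply: eq_bigr => s _; rewrite FG. Qed.

Hypothesis nu_gt0 : forall s, 0 < nu s.
Hypothesis nu_sum1 : \sum_s nu s = 1.

Lemma average_const y F z :
  (forall s, F (set_at z y s) = F z) -> average y F z = F z.
Proof.
by move=> Fz; under [LHS]eq_bigr do rewrite Fz; rewrite -mulr_suml nu_sum1 mul1r.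
Qed.

Lemma set_at_eq y s z : set_at z y s y = s.
Proof. by rewrite /set_at eqxx. Qed.

Lemma set_at_notin L y s z : y \notin L -> {in L, set_at z y s =1 z}.
Proof. by move=> yL x xL; rewrite /set_at; case: eqP xL yL => // -> ->. Qed.

Lemma average_eval f L y z : y \notin L -> average y (eval f L) z = eval f L z.
Proof.
by move=> yL; apply: average_const => s; apply: eq_eval; exact: set_at_notin.
Qed.

Lemma conditional_expectation1 (A : {fset X}) (y : X) (AyA : A `<=` y |` A)
    (F : config (y |` A) S -> R) z :
  y \notin A ->
  conditional_expectation nu AyA F (restrict A z) =
  average y (fun z => F (restrict (y |` A) z)) z.
Proof.
move=> yA; rewrite /conditional_expectation /average.
(* The fibre is parametrized by the state at [y]. The weight of the coordinates in [A] cancels and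
   leaves [nu s]. *)
rewrite (reindex_onto (fun s => restrict (y |` A) (set_at z y s))
                      (fun eta => eta [` fset1U1 y A])) /=; last first.
  move=> eta /eqP etaE; apply/ffunP => x; rewrite ffunE /set_at.
  case: eqP => [xy|/eqP xy]; first by congr (eta _); exact: val_inj.
  have xA : val x \in A by have := valP x; rewrite !inE (negPf xy).
  have := congr1 (fun k : config A S => k [` xA]) etaE; rewrite !ffunE => <-.
  by congr (eta _); exact: val_inj.
rewrite mulr_sumr; apply: eq_big => [s|s _].
  rewrite restriction_restrict; apply/andP; split.
    by apply/eqP/eq_restrict; exact: set_at_notin.
  by rewrite ffunE /set_at eqxx.
rewrite !product_measure_restrict big_fsetU1 //= set_at_eq.
have -> : \prod_(x <- A) nu (set_at z y s x) = \prod_(x <- A) nu (z x).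
  by apply: eq_big_seq => x xA; rewrite (set_at_notin _ _ yA).
set p := \prod_(x <- A) _.
have p0 : p != 0 by apply: lt0r_neq0; apply: prodr_gt0.
by set q := F _; rewrite (mulrC (nu s)) (mulrCA q) mulKf // mulrC.
Qed.

Lemma conditional_expectation_tower L M N (LM : L `<=` M) (MN : M `<=` N)
    (LN : L `<=` N) (F : config N S -> R) :
  conditional_expectation nu LM (conditional_expectation nu MN F) =
  conditional_expectation nu LN F.
Proof.
apply/funext => eta; rewrite /conditional_expectation; congr (_ * _).
rewrite [RHS](partition_big (restriction MN)
  (fun eta' => restriction LM eta' == eta)); last first.
  move=> zeta /eqP <-; apply/eqP/ffunP => x; rewrite !ffunE.
  by congr (zeta _); exact: val_inj.
apply: eq_bigr => eta' /eqP eta'E.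
rewrite mulrAC mulVf ?mul1r; last exact/lt0r_neq0/product_measure_gt0.
apply: eq_bigl => zeta; apply/eqP/andP => [zetaE|[_ /eqP//]].
rewrite zetaE; split=> //; rewrite -eta'E -zetaE; apply/eqP/ffunP => x; rewrite !ffunE.
by congr (zeta _); exact: val_inj.
Qed.

Lemma conditional_expectation_id L (LL : L `<=` L) (F : config L S -> R) :
  conditional_expectation nu LL F = F.
Proof.
have rid eta : restriction LL eta = eta :> config L S.
  by apply/ffunP => x; rewrite ffunE; congr (eta _); exact: val_inj.
apply/funext => eta; rewrite /conditional_expectation (big_pred1 eta).
  by rewrite mulrC mulfK //; exact/lt0r_neq0/product_measure_gt0.
by move=> eta'; rewrite rid.
Qed.

Lemma expectation_fset0 L (F : config L S -> R) z :
  expectation nu F = conditional_expectation nu (fsub0set L) F (restrict fset0 z).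
Proof.
rewrite /conditional_expectation product_measure_restrict big_seq_fset0 invr1 mul1r.
apply: eq_bigl => eta; apply/esym/eqP/ffunP => x.
by have := valP x; rewrite inE.
Qed.

(** By the tower property, compatibility reduces to adding one point at a time. The expectation is
    the conditional expectation on the empty set, so one normalization suffices. *)
Lemma colocal_functionE (s0 : S) f :
  colocal_function nu f <->
  (forall A y z, y \notin A -> average y (eval f (y |` A)) z = eval f A z) /\
  (forall z, eval f fset0 z = 0).
Proof.
split=> [[f0 fC]|[fC f0]].
  split=> [A y z yA|z].
    by rewrite -(conditional_expectation1 (fsubsetU1 y A)) // fC.
  rewrite -(f0 fset0) (expectation_fset0 _ z) /eval.
  by rewrite [fsub0set _](bool_irrelevance _ (fsubset_refl _)) conditional_expectation_id.
have CE L M (LM : L `<=` M) : conditional_expectation nu LM (f M) = f L.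
  have [n] := ubnP #|` M `\` L|; elim: n L LM => // n IH L LM ltn.
  have [ML|/fset0Pn[y]] := eqVneq (M `\` L) fset0.
    have ME : M = L by apply/eqP; rewrite eqEfsubset LM -fsetD_eq0 ML eqxx.
    by subst M; exact: conditional_expectation_id.
  rewrite inE => /andP[yL yM].
  have yLM : (y |` L) `<=` M by rewrite fsubUset fsub1set yM.
  rewrite -(conditional_expectation_tower (fsubsetU1 y L) yLM) IH; last first.
    have -> : M `\` (y |` L) = (M `\` L) `\ y.
      by apply/fsetP => x; rewrite !inE negb_or andbA.
    by move: ltn; rewrite (cardfsD1 y) !inE yL yM.
  apply/funext => eta; have [z <-] := restrict_surj s0 eta.
  by rewrite conditional_expectation1 // fC.
split=> // L; rewrite (expectation_fset0 _ (fun=> s0)) CE.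
exact: f0.
Qed.

End TotalConfigurations.

(** * Surjectivity of the differential onto closed co-local forms *)

Section Exactness.
Local Open Scope fset_scope.
Local Open Scope ring_scope.
Context (R : realType) (X : choiceType) (S : finType) (E : rel X).
Context (phi : S * S -> S * S) (nu : S -> R).
Implicit Types (L M : {fset X}).

Hypothesis nu_gt0 : forall s, 0 < nu s.
Hypothesis nu_sum1 : \sum_s nu s = 1.

Lemma differential_eq L (w : transitions (edge_in E (L := L)) phi -> R)
    (f : config L S -> R) :
  (forall e eta, edge_in E e.1 e.2 ->
     form_component w e eta = f (update phi eta e) - f eta) ->
  differential f = w.
Proof.
move=> fw; apply/funext => p.
have /existsP[e /and3P[Ee /eqP pE _]] := valP p.
rewrite /differential pE -fw // /form_component -pE /form_value.
by rewrite -surjective_pairing valK.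
Qed.

(** Conditional expectation is adjoint, for the pairing by the measure, to pulling back along
    restriction. *)
Lemma sum_conditional_expectation L M (LM : L `<=` M) (f : config M S -> R)
    (g : config L S -> R) :
  \sum_eta conditional_expectation nu LM f eta * g eta * product_measure nu eta =
  \sum_eta f eta * g (restriction LM eta) * product_measure nu eta.
Proof.
rewrite [RHS](partition_big (restriction LM) predT) //=; apply: eq_bigr => eta _.
rewrite /conditional_expectation mulrAC (mulrC _^-1) divfK;
  last exact/lt0r_neq0/product_measure_gt0.
rewrite mulr_suml; apply: eq_bigr => eta' /eqP ->.
by rewrite mulrAC.
Qed.

Section FixForm.
Context (w : form_families R E phi).
Arguments w : clear implicits.
Hypothesis w_closed : colocal_closed_form nu w.

Definition normalized_primitive L (f : config L S -> R) : Prop :=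
  differential f = w L /\ expectation nu f = 0.

Lemma normalized_primitive_expectation L M (LM : L `<=` M) (f : config M S -> R) :
  normalized_primitive f ->
  normalized_primitive (conditional_expectation nu LM f).
Proof.
move=> [df f0]; split; last first.
  have := sum_conditional_expectation LM f (fun=> 1).
  under eq_bigr do rewrite mulr1; move=> e; rewrite [LHS]e -[RHS]f0.
  by apply: eq_bigr => eta _; rewrite mulr1.
apply: differential_eq => e eta Ee.
have <- := w_closed.2 L M LM e Ee; rewrite -df.
have -> : form_component (differential f : form_space R E phi M)
    (fincl LM e.1, fincl LM e.2) =
  -1 *: (f : function_space R S M) +
  (fun eta => f (update phi eta (fincl LM e.1, fincl LM e.2))).
  apply/funext => eta'; rewrite [LHS]form_component_differential //.
  by rewrite addrC -[- (f eta' : R^o)]scaleN1r.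
rewrite conditional_expectation_linear conditional_expectation_update //.
by rewrite !fctE scaleN1r addrC.
Qed.

(* Pairing with the measure identifies a co-local function with a linear
   functional on local functions; g represents a local function on which every
   normalized primitive of w takes the value r. *)
Definition prescribed L (g : config L S -> R) (r : R) : Prop :=
  forall f, normalized_primitive f ->
    \sum_eta f eta * g eta * product_measure nu eta = r.

(** By adjunction the prescribed value survives when a local function is represented on a larger
    set. *)
Lemma prescribed_restriction L M (LM : L `<=` M) (g : config L S -> R) r :
  prescribed g r -> prescribed (fun eta => g (restriction LM eta)) r.
Proof.
move=> gr f /(normalized_primitive_expectation LM)/gr.
by rewrite sum_conditional_expectation.
Qed.

Hypothesis E_sym : symmetric E.
Hypothesis E_irr : irreflexive E.
Hypothesis phi_interaction : is_interaction phi.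

Lemma normalized_primitive_exists L :
  exists f : config L S -> R, normalized_primitive f.
Proof.
have [||||f df f0] :=
    @closed_form_primitive0 R _ S nu nu_sum1 (edge_in E (L := L)) phi (w L).
- by move=> x y; exact: E_sym.
- by move=> x; exact: E_irr.
- exact: phi_interaction.
- exact: (w_closed.1 L).2.
- by exists f.
Qed.

Definition local_graph : set (((X -> S) -> R^o) * R) :=
  [set q | exists L (g : config L S -> R),
     (forall z, q.1 z = g (restrict L z)) /\ prescribed g q.2]%classic.

(** Sums are formed on the union of the two supports. Single-valuedness holds because each finite
    set carries a normalized primitive to test against. *)
Lemma local_graph_linear (s0 : S) : linear_graph local_graph.
Proof.
split=> [|a u r v s [L [g [ug gr]]] [M [h [vh hs]]]|r [L [g [g0 gr]]]].
- exists fset0, (fun=> 0); split=> // f _.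
  by rewrite big1 // => eta _; rewrite mulr0 mul0r.
- have [LN MN] := (fsubsetUl L M, fsubsetUr L M).
  exists (L `|` M), (fun eta => a * g (restriction LN eta) + h (restriction MN eta)).
  split=> [z|f fw] /=.
    by rewrite !restriction_restrict -(ug z) -(vh z).
  have /= <- := prescribed_restriction LN gr fw.
  have /= <- := prescribed_restriction MN hs fw.
  rewrite mulr_sumr -big_split; apply: eq_bigr => eta _ /=.
  by rewrite mulrDr mulrDl; congr (_ + _); rewrite !mulrA (mulrC (f _)).
- have [f /gr /= <-] := normalized_primitive_exists L.
  apply: big1 => eta _; have [z <-] := restrict_surj s0 eta.
  by rewrite -(g0 z) mulr0 mul0r.
Qed.

Lemma colocal_primitive (s0 : S) :
  exists2 f, colocal_function nu f & family_differential E phi f = w.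
Proof.
have [l [lD lP]] := linear_graph_total (local_graph_linear s0).
have l0 : l 0 = 0 by apply: lP; have [] := local_graph_linear s0.
have lZ a u : l (a *: u) = a * l u by have := lD a u 0; rewrite l0 !addr0.
have lA u v : l (u + v) = l u + l v by have := lD 1 u v; rewrite scale1r mul1r.
have lsum (I : Type) (s : seq I) (P : pred I) F :
    l (\sum_(i <- s | P i) F i) = \sum_(i <- s | P i) l (F i).
  by elim/big_rec2: _ => // i x y _ <-; rewrite lA.
pose ind L (eta : config L S) : (X -> S) -> R^o :=
  fun z => (restrict L z == eta)%:R.
have mu0 L (eta : config L S) : product_measure nu eta != 0.
  exact/lt0r_neq0/product_measure_gt0.
pose f : function_families R X S :=
  (* A co-local function is recovered from its functional by evaluating on the indicator of a
     cylinder and dividing by the mass of that cylinder. *)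
  fun L eta => l (ind L eta) / product_measure nu eta.
have fmu L eta : f L eta * product_measure nu eta = l (ind L eta) by rewrite divfK.
exists f.
  split=> [L|L M LM].
    rewrite /expectation; under eq_bigr do rewrite fmu.
    (* The indicators add up to the constant 1, whose prescribed value is the mean 0 of a normalized
       primitive. *)
    rewrite -lsum; apply: lP.
    exists L, (fun=> 1); split=> [z|g [_ g0]] /=; last first.
      by rewrite -[RHS]g0; apply: eq_bigr => eta _; rewrite mulr1.
    rewrite fct_sumE (bigD1 (restrict L z)) //= /ind eqxx big1 ?addr0 // => eta.
    by rewrite eq_sym => /negPf ->.
  apply/funext => eta; rewrite /conditional_expectation.
  under eq_bigr do rewrite fmu.
  (* The cylinder of [eta] is the disjoint union of the cylinders of the configurations that
     restrict to it. *)
  rewrite -lsum mulrC; congr (l _ / _); apply/funext => z; rewrite fct_sumE /ind.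
  rewrite -(restriction_restrict LM) -[RHS]/((_)%:R).
  case: eqP => [<-|ne].
    rewrite (bigD1 (restrict M z)) //= eqxx big1 ?addr0 // => eta' /andP[_].
    by rewrite eq_sym => /negPf ->.
  rewrite big1 // => eta' /eqP eta'E; case: eqP => // e.
  by case: ne; rewrite e.
apply: functional_extensionality_dep => L; apply: differential_eq => e eta Ee.
set eta' := update phi eta e.
pose c (k : config L S) := (product_measure nu k)^-1.
have -> : f L eta' - f L eta = l (c eta' *: ind L eta' + (- c eta) *: ind L eta).
  by rewrite lA !lZ mulNr /f (mulrC (c eta')) (mulrC (c eta)).
(* This local function pairs with any primitive g to g eta' - g eta, a value that the form
   determines. *)
apply/esym/lP; exists L, (fun k => c eta' * (k == eta')%:R - c eta * (k == eta)%:R).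
split=> [z|g [dg _]] /=; first by rewrite -mulNr.
rewrite -dg form_component_differential //.
under eq_bigr do rewrite mulrBr mulrBl.
rewrite sumrB; have pick (k : config L S) :
    \sum_i g i * (c k * (i == k)%:R) * product_measure nu i = g k.
  rewrite (bigD1 k) //= eqxx mulr1 /c divfK // big1 ?addr0 // => i /negPf ->.
  by rewrite !mulr0 mul0r.
by rewrite !pick.
Qed.

End FixForm.

End Exactness.

(** * The group action on co-local functions *)

Section TranslateEval.
Local Open Scope fset_scope.
Local Open Scope ring_scope.
Context (R : realType) (X : choiceType) (S : finType) (E : rel X).
Context (G : groupType) (A : locale_action G E).
Implicit Types (s t : G) (L : {fset X}).

Lemma actionK s : cancel (A s) (A s^-1%g).
Proof. by move=> x; rewrite -actionM mulVg action1. Qed.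

Lemma actionVK s : cancel (A s^-1%g) (A s).
Proof. by move=> x; rewrite -actionM mulgV action1. Qed.

Lemma action_inj s : injective (A s). Proof. exact: can_inj (actionK s). Qed.

Lemma eval_translate s (f : function_families R X S) L z :
  eval (translate_function A s f) L z = eval f (translate A s^-1%g L) (z \o A s).
Proof.
rewrite /eval /translate_function; congr (f _ _); apply/ffunP => x.
by rewrite !ffunE /= invgK.
Qed.

Lemma mem_translate s L x : (A s x \in translate A s L) = (x \in L).
Proof.
apply/imfsetP/idP => [[y /= yL /action_inj ->]//|xL].
by exists x.
Qed.

Lemma translate_fset0 s : translate A s fset0 = fset0.
Proof. exact: imfset0. Qed.

Lemma translateU1 s x L : translate A s (x |` L) = A s x |` translate A s L.
Proof. exact: imfsetU1. Qed.

Lemma translate_functionM (s0 : S) s t (f : function_families R X S) :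
  translate_function A (s * t)%g f = translate_function A s (translate_function A t f).
Proof.
apply: (eval_inj s0) => L z; rewrite !eval_translate.
have -> : translate A (s * t)^-1%g L = translate A t^-1%g (translate A s^-1%g L).
  rewrite /translate -imfset_comp; apply/fsetP => x.
  by apply/imfsetP/imfsetP => -[y /= yL ->]; exists y => //; rewrite invgM actionM.
by apply: eq_eval => x _ /=; rewrite actionM.
Qed.

Lemma translate_C0_col (s0 : S) (nu : S -> R) s (f : function_families R X S) :
  (forall u, 0 < nu u) ->
  C0_col X nu f -> C0_col X nu (translate_function A s f).
Proof.
move=> nu_gt0 /(colocal_functionE nu_gt0 s0)[fC f0].
apply/(colocal_functionE nu_gt0 s0); split=> [B y z yB|z]; last first.
  by rewrite eval_translate translate_fset0.
rewrite eval_translate -(fC _ (A s^-1%g y)) ?mem_translate //.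
apply: eq_bigr => u _; rewrite eval_translate translateU1; congr (_ * _).
by apply: eq_eval => x _; rewrite /= /set_at (can2_eq (actionK s) (actionVK s)).
Qed.

End TranslateEval.

(** * Symmetry of [H0_col] and triviality of the action on it *)

Section Cocycles.
Local Open Scope fset_scope.
Local Open Scope ring_scope.
Context (R : realType) (X : choiceType) (S : finType) (E : rel X).
Context (phi : S * S -> S * S) (nu : S -> R).
Implicit Types (L M A B : {fset X}).

Lemma edge_in_locale M : is_locale E ->
  (exists2 x0, x0 \in M & forall y, y \in M ->
     exists p, [/\ path E x0 p, {subset p <= M} & last x0 p = y]) ->
  is_locale (edge_in E (L := M)).
Proof.
move=> [E_sym E_irr _ _] [x0 x0M pM].
have sym : symmetric (edge_in E (L := M)) by move=> x y; exact: E_sym.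
have conn (p : seq X) (u v : M) : path E (val u) p -> {subset p <= M} ->
    last (val u) p = val v -> connect (edge_in E (L := M)) u v.
  elim: p u => [|a p IH] u /=; first by move=> _ _ /val_inj ->.
  move=> /andP[ua pa] sp lp.
  have aM : a \in M by apply: sp; rewrite mem_head.
  apply: (@connect_trans _ _ [` aM]); first exact: connect1.
  by apply: IH => // b bp; apply: sp; rewrite inE bp orbT.
have conn0 (v : M) : connect (edge_in E (L := M)) [` x0M] v.
  by have [p [pp sp lp]] := pM _ (valP v); exact: (conn p).
split=> // [x|x y]; first exact: E_irr.
have : connect (edge_in E (L := M)) x y.
  by apply: connect_trans (conn0 y); rewrite (sym_connect_sym sym).
by move=> /connectP[p pp lp]; exists p.
Qed.

(** Irreducible quantification applies to connected finite graphs. Chosen paths from one point of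
    [A] to all of its points make up such a graph. *)
Lemma locale_superset A : is_locale E ->
  exists2 M, A `<=` M & is_locale (edge_in E (L := M)).
Proof.
move=> Eloc; have [->|/fset0Pn[x0 x0A]] := eqVneq A fset0.
  exists fset0 => //; split=> x; by have := valP x; rewrite inE.
have ex x : exists p, path E x0 p && (last x0 p == x).
  by have [p pp lp] := locale_connected Eloc x0 x; exists p; rewrite pp lp eqxx.
pose p x := projT1 (cid (ex x)).
have pP x : path E x0 (p x) by rewrite /p; case: cid => q /= /andP[].
have pl x : last x0 (p x) = x by rewrite /p; case: cid => q /= /andP[_ /eqP].
pose l := flatten [seq x0 :: p x | x <- A].
have lE y : (y \in [fset y in l]) = (y \in l) by rewrite inE.
have x0l : x0 \in l by apply/flatten_mapP; exists x0; rewrite // mem_head.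
exists [fset y in l].
  apply/fsubsetP => x xA; rewrite lE; apply/flatten_mapP; exists x => //.
  by rewrite -[X in X \in _](pl x) mem_last.
apply: edge_in_locale => //; exists x0; first by rewrite lE.
move=> y; rewrite lE => /flatten_mapP[x xA].
rewrite inE => /predU1P[->|yp]; first by exists [::].
have pM : {subset p x <= [fset y in l]}.
  by move=> b bp; rewrite lE; apply/flatten_mapP; exists x; rewrite // inE bp orbT.
(* The part of the path up to [y] joins the base point to [y] inside the set. *)
move: pM (pP x); case/splitPr: yp => p1 p2 pM.
rewrite -cat_rcons cat_path => /andP[pp _].
exists (rcons p1 y); split; rewrite ?last_rcons // => b bp.
by apply: pM; rewrite -cat_rcons mem_cat bp.
Qed.

Hypothesis nu_gt0 : forall s, 0 < nu s.
Hypothesis phi_irreducible : irreducibly_quantified phi nu.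
Variable s0 : S.

Lemma cocycle_path (f : function_families R X S) M (eta eta' : config M S) :
  family_differential E phi f = 0 -> has_path (edge_in E (L := M)) phi eta eta' ->
  f M eta = f M eta'.
Proof.
move=> df [p pp <-]; elim: p eta pp => //= a p IH eta /andP[tr pa].
rewrite -IH //; apply/esym/eqP; rewrite -subr_eq0; apply/eqP.
have := congr1 (fun w : form_families R E phi =>
  w M (exist (fun p => transition _ _ p.1 p.2) (eta, a) tr)) df.
by [].
Qed.

(* Permuting the values of a configuration preserves every conserved quantity,
   so irreducible quantification joins both configurations by a path. *)
Lemma cocycle_symmetric (f : function_families R X S) M z z' :
  family_differential E phi f = 0 -> is_locale (edge_in E (L := M)) ->
  perm_eq [seq z x | x <- M] [seq z' x | x <- M] ->
  eval f M z = eval f M z'.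
Proof.
move=> df Mloc zz'; apply: cocycle_path df _; apply: phi_irreducible => // xi _.
have sE (u : X -> S) : \sum_(y : M) xi (restrict M u y) =
    \sum_(s <- [seq u x | x <- M]) xi s.
  by rewrite big_map big_seq_fsetE; apply: eq_bigr => y _; rewrite ffunE.
by rewrite !sE; exact: perm_big.
Qed.

Lemma perm_fset1U x A : x \notin A -> perm_eq (x |` A) (x :: A).
Proof.
move=> xA; apply: uniq_perm => [||y]; rewrite ?fset_uniq //= ?xA ?fset_uniq //.
by rewrite !inE.
Qed.

(** Both sets are enlarged one point at a time inside a common finite locale [M], averaging over the
    new state. Having equal size they reach [M] together, where permutation symmetry applies. *)
Lemma cocycle_multiset (f : function_families R X S) A B z z' :
  is_locale E -> H0_col E phi nu f ->
  perm_eq [seq z x | x <- A] [seq z' x | x <- B] ->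
  eval f A z = eval f B z'.
Proof.
move=> Eloc [/(colocal_functionE nu_gt0 s0)[fC _] df].
have [M ABM Mloc] := locale_superset (A `|` B) Eloc.
move: ABM; rewrite fsubUset => /andP[].
have [n] := ubnP #|` M `\` A|; elim: n A B z z' => // n IH A B z z' ltn AM BM AB.
have card_AB : #|` A| = #|` B| by have := perm_size AB; rewrite !size_map.
have [MA|/fset0Pn[x]] := eqVneq (M `\` A) fset0.
  have AE : A = M by apply/eqP; rewrite eqEfsubset AM -fsetD_eq0 MA eqxx.
  have BE : B = M by apply/eqP; rewrite eqEfcard BM -card_AB AE leqnn.
  by move: AB; rewrite AE BE; exact: cocycle_symmetric.
have [MB|/fset0Pn[y]] := eqVneq (M `\` B) fset0.
  have BE : B = M by apply/eqP; rewrite eqEfsubset BM -fsetD_eq0 MB eqxx.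
  have AE : A = M by apply/eqP; rewrite eqEfcard AM card_AB BE leqnn.
  by rewrite AE fsetDv inE.
rewrite !inE => /andP[yB yM] /andP[xA xM].
(* The new points [x] and [y] receive the same state [s], so the two multisets stay equal. *)
rewrite -(fC A x) // -(fC B y) //; apply: eq_bigr => s _; congr (_ * _).
apply: IH; rewrite ?fsubUset ?fsub1set ?xM ?yM //.
  have -> : M `\` (x |` A) = (M `\` A) `\ x.
    by apply/fsetP => b; rewrite !inE negb_or andbA.
  by move: ltn; rewrite (cardfsD1 x) !inE xA xM.
have mapE C u (v : X -> S) : u \notin C ->
    perm_eq [seq set_at v u s b | b <- u |` C] (s :: [seq v b | b <- C]).
  move=> uC; apply: (perm_trans (perm_map _ (perm_fset1U uC))) => /=.
  rewrite set_at_eq perm_cons.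
  suff -> : [seq set_at v u s b | b <- C] = [seq v b | b <- C] by [].
  by apply/eq_in_map => b bC; rewrite (set_at_notin _ _ uC).
apply: perm_trans (mapE _ _ _ xA) _; rewrite perm_sym.
by apply: perm_trans (mapE _ _ _ yB) _; rewrite perm_cons perm_sym.
Qed.

(** Translation moves the sites but keeps the multiset of values. *)
Lemma H0_col_invariant (G : groupType) (act : locale_action G E) s
    (f : function_families R X S) :
  is_locale E -> H0_col E phi nu f -> translate_function act s f = f.
Proof.
move=> Eloc fH; apply: (eval_inj s0) => L z; rewrite eval_translate.
apply: cocycle_multiset => //.
have pt : perm_eq (translate act s^-1%g L) [seq act s^-1%g x | x <- L].
  by apply: enum_imfset => x y _ _; exact: action_inj.
apply: perm_trans (perm_map _ pt) _; rewrite -map_comp.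
suff -> : [seq ((z \o act s) \o act s^-1%g) x | x <- L] = [seq z x | x <- L] by [].
by apply/eq_in_map => x _ /=; rewrite actionVK.
Qed.

End Cocycles.

(** * Moebius inversion over finite subsets *)

Section Moebius.
Local Open Scope fset_scope.
Local Open Scope ring_scope.
Context (R : comNzRingType) (X : choiceType).
Implicit Types (B C L : {fset X}) (g : {fset X} -> R).

(** The exponent is a sum, with the same parity as the difference of cardinalities, to avoid
    truncated subtraction. *)
Definition moebius g B : R :=
  \sum_(C <- fpowerset B) (-1) ^+ (#|` B| + #|` C|) * g C.

Lemma eq_moebius g g' B :
  (forall C, C `<=` B -> g C = g' C) -> moebius g B = moebius g' B.
Proof.
by move=> gg'; apply: eq_big_seq => C; rewrite fpowersetE => /gg' ->.
Qed.

Lemma big_fpowersetU1 (F : {fset X} -> R) y B : y \notin B ->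
  \sum_(C <- fpowerset (y |` B)) F C =
  \sum_(C <- fpowerset B) F C + \sum_(C <- fpowerset B) F (y |` C).
Proof.
move=> yB; have yC C : C \in fpowerset B -> y \notin C.
  by rewrite fpowersetE => /fsubsetP CB; apply: contra yB; exact: CB.
rewrite -(big_map (fun C => y |` C) predT F) -big_cat; apply: perm_big.
apply: uniq_perm; first exact: fset_uniq.
  rewrite cat_uniq fset_uniq map_inj_in_uniq ?fset_uniq ?andbT /=; last first.
    move=> C D /yC yC' /yC yD /(congr1 (fun Z => Z `\ y)).
    by rewrite !fsetU1K.
  apply/hasPn => _ /mapP[C CB ->]; apply/negP => /yC; by rewrite fset1U1.
move=> C; rewrite mem_cat !fpowersetE; apply/idP/orP.
  move=> CyB; have [yC'|yC'] := boolP (y \in C); last first.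
    left; apply/fsubsetP => x xC; have := fsubsetP CyB _ xC.
    by rewrite !inE => /predU1P[xy|//]; rewrite -xy xC in yC'.
  right; apply/mapP; exists (C `\ y); last by rewrite fsetD1K.
  by rewrite fpowersetE fsubDset.
case=> [CB|/mapP[D]]; first exact: fsubset_trans CB (fsubsetU1 _ _).
by rewrite fpowersetE => DB ->; exact: fsetUS.
Qed.

Lemma moebiusU1 g y B : y \notin B ->
  moebius g (y |` B) = moebius (fun C => g (y |` C) - g C) B.
Proof.
move=> yB; rewrite /moebius big_fpowersetU1 // -big_split; apply: eq_big_seq => C.
rewrite fpowersetE => /fsubsetP CB.
have yC : y \notin C by apply: contra yB; exact: CB.
rewrite /= !cardfsU1 yB yC !addnS !addSn !exprS /=.
by rewrite !mulN1r !mulNr opprK mulrBr addrC.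
Qed.

Lemma moebius_inversion g L : \sum_(B <- fpowerset L) moebius g B = g L.
Proof.
elim/fset1U_rect: L g => [|y L yL IH] g.
  rewrite fpowerset0 big_seq_fset1 /moebius fpowerset0 big_seq_fset1.
  by rewrite cardfs0 mul1r.
rewrite big_fpowersetU1 // IH -[RHS](subrK (g L)) addrC; congr (_ + _).
(* The subsets containing [y] contribute the increment of [g] at [L], by induction applied to the
   difference function. *)
rewrite -(IH (fun C => g (y |` C) - g C)); apply: eq_big_seq => B.
rewrite fpowersetE => /fsubsetP BL; rewrite moebiusU1 //.
by apply: contra yL; exact: BL.
Qed.

Lemma big_fpowerset_imfset (h : X -> X) (F : {fset X} -> R) L : injective h ->
  \sum_(B <- fpowerset [fset h x | x in L]) F B =
  \sum_(B <- fpowerset L) F [fset h x | x in B].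
Proof.
move=> h_inj; elim/fset1U_rect: L F => [|y L yL IH] F.
  by rewrite imfset0 !fpowerset0 !big_seq_fset1 imfset0.
rewrite imfsetU1 !big_fpowersetU1 //; last first.
  by apply: contra yL => /imfsetP[x /= xL /h_inj ->].
by rewrite !IH; congr (_ + _); apply: eq_bigr => B _; rewrite imfsetU1.
Qed.

Lemma moebius_imfset (h : X -> X) g B : injective h ->
  moebius g [fset h x | x in B] = moebius (fun C => g [fset h x | x in C]) B.
Proof.
move=> h_inj; rewrite /moebius big_fpowerset_imfset //; apply: eq_bigr => C _.
by rewrite !card_imfset.
Qed.

End Moebius.

(** * An equivariant map from the sites to the group *)

Section OrbitSections.
Context (X : choiceType) (E : rel X) (G : groupType) (A : locale_action G E).

(** The value t x is the element that carries the chosen representative of the orbit to x. Freeness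
    makes it unique, which gives equivariance. *)
Lemma free_action_section : free_action A ->
  exists t : X -> G, forall s x, t (A s x) = (s * t x)%g.
Proof.
move=> freeA.
pose orb x : pred X := fun y => `[< exists s, A s x = y >].
have orb_id x : orb x x by apply/asboolP; exists 1%g; rewrite action1.
pose rep x := choose (orb x) x.
have ex x : exists s, A s (rep x) = x.
  have /asboolP[s sx] : orb x (rep x) by exact: chooseP.
  by exists s^-1%g; rewrite -sx actionK.
have repA s x : rep (A s x) = rep x.
  (* The canonical choice depends only on the orbit as a predicate, so both points get the same
     representative. *)
  have orbE : orb (A s x) =1 orb x.
    move=> y; apply/asboolP/asboolP => -[u uy].
      by exists (u * s)%g; rewrite actionM.
    by exists (u * s^-1)%g; rewrite actionM actionK.
  rewrite /rep (eq_choose orbE); apply: choose_id => //.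
  by apply/asboolP; exists s.
exists (fun x => projT1 (cid (ex x))) => s x.
case: cid => u /= ux; case: cid => v /= vx.
have uE : A u (rep x) = A (s * v)%g (rep x) by rewrite actionM vx -(repA s).
have : A ((s * v)^-1 * u)%g (rep x) = rep x by rewrite actionM uE actionK.
by move=> /freeA /(congr1 (fun g => (s * v) * g)%g); rewrite mulVKg mulg1.
Qed.

End OrbitSections.

(** * Homomorphisms to invariant functions become coboundaries *)

Section Coboundary.
Local Open Scope fset_scope.
Local Open Scope ring_scope.
Context (R : realType) (X : choiceType) (S : finType) (E : rel X).
Context (nu : S -> R) (G : groupType) (A : locale_action G E).
Context (s0 : S) (tr : X -> G).
Implicit Types (B C L : {fset X}) (z : X -> S) (h : G -> function_families R X S).

Hypothesis nu_gt0 : forall s, 0 < nu s.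
Hypothesis nu_sum1 : \sum_s nu s = 1.
Hypothesis trM : forall s x, tr (A s x) = (s * tr x)%g.

(** For a co-local [f] this is the part that depends on the coordinates in [B] and averages to zero
    in each of them. *)
Definition component (f : function_families R X S) B z : R :=
  moebius (fun C => eval f C z) B.

Lemma eq_component f B z z' : {in B, z =1 z'} -> component f B z = component f B z'.
Proof.
move=> zz; apply: eq_moebius => C /fsubsetP CB; apply: eq_eval => x /CB.
exact: zz.
Qed.

Lemma component_linear a f g B z :
  component (a *: f + g) B z = a * component f B z + component g B z.
Proof.
rewrite /component /moebius mulr_sumr -big_split; apply: eq_bigr => C _ /=.
by rewrite eval_linear mulrDr mulrCA.
Qed.

Lemma component_translate s f B z :
  component f (translate A s^-1%g B) (z \o A s) =
  component (translate_function A s f) B z.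
Proof.
rewrite /component moebius_imfset; last exact: action_inj.
by apply: eq_moebius => C _; rewrite eval_translate.
Qed.

Lemma component_fset0 f z : C0_col X nu f -> component f fset0 z = 0.
Proof.
move=> /(colocal_functionE nu_gt0 s0)[_ f0].
by rewrite /component /moebius fpowerset0 big_seq_fset1 f0 mulr0.
Qed.

Lemma average_component f B y z : C0_col X nu f -> y \notin B ->
  average nu y (component f (y |` B)) z = 0.
Proof.
move=> /(colocal_functionE nu_gt0 s0)[fC _] yB.
rewrite /component (@eq_average _ _ _ _ _ _ (fun z => \sum_(C <- fpowerset B)
    (-1) ^+ (#|` B| + #|` C|) * (eval f (y |` C) z - eval f C z))); last first.
  by move=> z'; rewrite moebiusU1.
rewrite average_sum big1_seq // => C /= ; rewrite fpowersetE => /fsubsetP CB.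
have yC : y \notin C by apply: contra yB; exact: CB.
set c := _ ^+ _.
rewrite (@eq_average _ _ _ _ _ _ (fun z => c * (-1 * eval f C z + eval f (y |` C) z) + 0)).
  rewrite average_linear average_linear fC // average_eval //.
  rewrite mulN1r addNr mulr0 add0r.
  by rewrite /average big1 // => s _; rewrite mulr0.
by move=> z'; rewrite addr0 mulN1r addrC.
Qed.

(* Splitting the pure component on B evenly between the points of B reduces the
   choice of orbit representatives from finite subsets to points of X. *)
Definition coboundary_component h B z : R :=
  #|` B|%:R^-1 * \sum_(x <- B) component (h (tr x)) B z.

Definition coboundary_eval h L z : R :=
  \sum_(B <- fpowerset L) coboundary_component h B z.

(** The state [s0] only fills the sites outside [L]; the components summed read coordinates in
    subsets of [L]. *)
Definition coboundary h : function_families R X S :=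
  fun L eta => coboundary_eval h L (fun x => oapp eta s0 (insub x)).

Lemma eq_coboundary_component h B z z' : {in B, z =1 z'} ->
  coboundary_component h B z = coboundary_component h B z'.
Proof.
move=> zz; congr (_ * _); apply: eq_bigr => x _; exact: eq_component.
Qed.

Lemma eval_coboundary h L z : eval (coboundary h) L z = coboundary_eval h L z.
Proof.
apply: eq_big_seq => B; rewrite fpowersetE => /fsubsetP BL.
apply: eq_coboundary_component => x /BL xL.
by rewrite insubT /= ffunE.
Qed.

Lemma coboundary_linear a h k :
  coboundary (a *: h + k) = a *: coboundary h + coboundary k.
Proof.
apply: (eval_inj s0) => L z; rewrite eval_linear !eval_coboundary.
rewrite /coboundary_eval mulr_sumr -big_split; apply: eq_bigr => B _ /=.
rewrite /coboundary_component mulrCA -mulrDr; congr (_ * _).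
rewrite mulr_sumr -big_split; apply: eq_bigr => x _ /=.
exact: component_linear.
Qed.

(** Averaging at [y] fixes the components whose index set omits [y] and kills the others. *)
Lemma coboundary_colocal h : (forall s, C0_col X nu (h s)) ->
  C0_col X nu (coboundary h).
Proof.
move=> hC; apply/(colocal_functionE nu_gt0 s0); split=> [B y z yB|z]; last first.
  rewrite eval_coboundary /coboundary_eval fpowerset0 big_seq_fset1.
  by rewrite /coboundary_component big_seq_fset0 mulr0.
rewrite (eq_average _ _ _ (eval_coboundary h (y |` B))) average_sum.
rewrite eval_coboundary big_fpowersetU1 // [X in _ + X]big1_seq ?addr0.
  apply: eq_big_seq => C; rewrite fpowersetE => /fsubsetP CB.
  apply: average_const => // s; apply: eq_coboundary_component.
  by apply: set_at_notin; apply: contra yB; exact: CB.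
move=> C; rewrite /= fpowersetE => /fsubsetP CB.
have yC : y \notin C by apply: contra yB; exact: CB.
rewrite /average /coboundary_component.
under eq_bigr do rewrite mulrCA mulr_sumr.
rewrite -mulr_sumr exchange_big big1 ?mulr0 // => x _.
exact: average_component.
Qed.

(** Equivariance of [tr] turns h (tr x) into h (tr x) - h s. The same defect occurs at each point of
    [B], which cancels the factor 1 / #B. *)
Lemma coboundary_component_translate h s B z :
  (forall s, C0_col X nu (h s)) ->
  (forall s t, translate_function A s (h t) = h t) ->
  (forall s t, h (s * t)%g = h s + h t) ->
  coboundary_component h (translate A s^-1%g B) (z \o A s) =
  coboundary_component h B z - component (h s) B z.
Proof.
move=> hC hA hM; rewrite /coboundary_component.
rewrite card_imfset; last exact: action_inj.
rewrite big_imfset /=; last by move=> x y _ _; exact: action_inj.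
have -> : \sum_(x <- B) component (h (tr (A s^-1%g x)))
      (translate A s^-1%g B) (z \o A s) =
    \sum_(x <- B) component (h (tr x)) B z - #|` B|%:R * component (h s) B z.
  transitivity (\sum_(x <- B) (component (h (tr x)) B z - component (h s) B z)).
    apply: eq_bigr => x _; rewrite component_translate trM hA.
    have -> : h (s^-1 * tr x)%g = -1 *: h s + h (tr x).
      by rewrite -{2}(mulVKg s (tr x)) hM scaleN1r addKr.
    by rewrite component_linear mulN1r addrC.
  by rewrite sumrB big_const_seq count_predT iter_addr_0 mulr_natl.
(* The empty set admits no division by its size, but there the component of a co-local function is
   0. *)
have [->|B0] := eqVneq B fset0.
  by rewrite !big_seq_fset0 component_fset0 ?mulr0 ?subr0 ?mulr0.
by rewrite mulrBr mulKf // pnatr_eq0 cardfs_eq0.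
Qed.

(** The defects of the components are the pure components of [h s], and Moebius inversion sums them
    to [h s]. *)
Lemma coboundary_translate h s :
  (forall s, C0_col X nu (h s)) ->
  (forall s t, translate_function A s (h t) = h t) ->
  (forall s t, h (s * t)%g = h s + h t) ->
  translate_function A s (coboundary h) = coboundary h - h s.
Proof.
move=> hC hA hM; apply: (eval_inj s0) => L z.
have -> : coboundary h - h s = -1 *: h s + coboundary h by rewrite scaleN1r addrC.
rewrite eval_linear eval_translate !eval_coboundary /coboundary_eval.
rewrite big_fpowerset_imfset; last exact: action_inj.
under eq_bigr do rewrite coboundary_component_translate //.
by rewrite sumrB moebius_inversion mulN1r addrC.
Qed.

End Coboundary.

Lemma val_linear (R : pzRingType) (V : lmodType R) (U : subspace V) a (u v : U) :
  val (a *: u + v) = a *: val u + val v.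
Proof. by []. Qed.

(** * The complement of the exact forms among the invariant closed forms *)

Section Decomposition.
Context (R : realType) (X : choiceType) (E : rel X) (S : finType).
Context (phi : S * S -> S * S) (nu : S -> R) (G : groupType).
Context (A : locale_action G E) (s0 : S).
Hypothesis Eloc : is_locale E.
Hypothesis phi_interaction : is_interaction phi.
Hypothesis nu_gt0 : forall s, 0 < nu s.
Hypothesis nu_sum1 : \sum_s nu s = 1.
Hypothesis freeA : free_action A.
Hypothesis phi_irreducible : irreducibly_quantified phi nu.

Let Hom := Hom_Z E phi nu G.
Let Z1 := Z1_col_inv phi nu A.
Let B1 := B1_col_inv phi nu A.

Definition cocycle_of (h : Hom) (s : G) : function_families R X S := val (val h s).

Lemma cocycle_of_linear a (h k : Hom) :
  cocycle_of (a *: h + k) = a *: cocycle_of h + cocycle_of k.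
Proof.
apply/funext => s; rewrite /cocycle_of val_linear.
by rewrite -[LHS]/(val (a *: val h s + val k s)) val_linear.
Qed.

Lemma cocycle_of_H0 h s : H0_col E phi nu (cocycle_of h s).
Proof. exact/asboolP/(valP (val h s)). Qed.

Lemma cocycle_of_C0 h s : C0_col X nu (cocycle_of h s).
Proof. exact: (cocycle_of_H0 h s).1. Qed.

Lemma cocycle_of_invariant h s t :
  translate_function A s (cocycle_of h t) = cocycle_of h t.
Proof.
exact (H0_col_invariant nu_gt0 phi_irreducible s0 A s Eloc (cocycle_of_H0 h t)).
Qed.

Lemma cocycle_ofM h s t :
  cocycle_of h (s * t)%g = cocycle_of h s + cocycle_of h t.
Proof.
have hM : group_hom (val h) by exact/asboolP/(valP h).
by rewrite /cocycle_of hM.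
Qed.

Lemma family_differentialB (f g : function_families R X S) :
  family_differential E phi (f - g) =
  family_differential E phi f - family_differential E phi g.
Proof.
have := family_differential_linear E phi (-1) g f.
by rewrite !scaleN1r addrC [RHS]addrC.
Qed.

Lemma translate_functionB s (f g : function_families R X S) :
  translate_function A s (f - g) = translate_function A s f - translate_function A s g.
Proof. by []. Qed.

Lemma invariant_form_section :
  exists sg : {linear Hom -> Z1},
    (forall w, exists h, B1 (w - sg h)) /\ (forall h, B1 (sg h) -> h = 0).
Proof.
have [tr trM] := free_action_section freeA.
pose F (h : Hom) := coboundary s0 tr (cocycle_of h).
have FC h : C0_col X nu (F h).
  by apply: coboundary_colocal => // s; exact: cocycle_of_C0.
have FT h s : translate_function A s (F h) = F h - cocycle_of h s.
  apply: (coboundary_translate s0 nu_gt0 trM).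
  - exact: cocycle_of_C0.
  - exact: cocycle_of_invariant.
  - exact: cocycle_ofM.
have dcocycle h s : family_differential E phi (cocycle_of h s) = 0.
  exact: (cocycle_of_H0 h s).2.
have FP h : family_differential E phi (F h) \in mem_subspace Z1.
  apply/asboolP; split=> [|s].
    exact: (colocal_differential E phi nu_gt0 (FC h)).
  by rewrite translate_differential FT family_differentialB dcocycle subr0.
have [|sg sgE] := @linear_map_exists R Hom Z1
    (fun h => Sub (family_differential E phi (F h)) (FP h)).
  move=> a h k; apply: val_inj => /=.
  rewrite -family_differential_linear; congr (family_differential _ _ _).
  by rewrite /F cocycle_of_linear coboundary_linear.
have vsg h : val (sg h) = family_differential E phi (F h) by rewrite sgE.
exists sg; split=> [w|h [f [fC fA] df]].
  have [wZ wA] : Z1 (val w) by exact/asboolP/(valP w).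
  have [E_sym E_irr _ _] := Eloc.
  have [f fC df] :=
    colocal_primitive nu_gt0 nu_sum1 wZ E_sym E_irr phi_interaction s0.
  (* A primitive of an invariant form need not be invariant, but its defect under [s] has zero
     differential. *)
  have hP s : f - translate_function A s f \in mem_subspace (H0_col E phi nu).
    apply/asboolP; split; last first.
      by rewrite family_differentialB -translate_differential df wA subrr.
    rewrite addrC -scaleN1r; apply: carrierP => //.
    exact: translate_C0_col.
  pose h (s : G) : H0_col E phi nu := Sub (f - translate_function A s f) (hP s).
  have hM : group_hom h.
    move=> s t; apply: val_inj => /=; rewrite (translate_functionM A s0).
    (* The defect is a 1-cocycle; as the action on [H0_col] is trivial, it is a homomorphism. *)
    have := H0_col_invariant nu_gt0 phi_irreducible s0 A s Eloc (asboolW (hP t)).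
    rewrite translate_functionB => <-.
    have telescope (V : zmodType) (a b c : V) : a - c = a - b + (b - c).
      by rewrite addrA addrNK.
    exact: telescope.
  have hHom : h \in mem_subspace Hom by exact/asboolP.
  (* Both functions have the same defect under every [s], so their difference is an invariant
     primitive. *)
  exists (Sub h hHom), (f - F (Sub h hHom)); last first.
    by rewrite family_differentialB df -vsg.
  split=> [|s].
    rewrite addrC -scaleN1r; apply: carrierP => //; exact: FC.
  rewrite translate_functionB FT /cocycle_of /=.
  by rewrite opprB addrA (addrC (translate_function A s f)) addrNK.
apply: val_inj; apply/funext => s; apply: val_inj => /=.
(* With [f] an invariant primitive of [sg h], this difference has zero differential and is therefore
   invariant. Its defect under [s] is [h s], which must vanish. *)
have gH : H0_col E phi nu (F h - f).
  split; last by rewrite family_differentialB df vsg subrr.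
  rewrite addrC -scaleN1r; apply: carrierP => //; exact: FC.
have := H0_col_invariant nu_gt0 phi_irreducible s0 A s Eloc gH.
rewrite translate_functionB fA FT addrAC -[RHS]subr0 => /addrI/oppr_inj.
exact.
Qed.

End Decomposition.

Theorem corollary4p8 (R : realType) (X : choiceType) (E : rel X) (S : finType)
    (phi : S * S -> S * S) (nu : S -> R) (G : groupType)
    (A : locale_action G E) :
  is_locale E ->
  (0 < #|S|)%N ->
  is_interaction phi ->
  (forall s, 0 < nu s) -> \sum_s nu s = 1 ->
  torsion_free G ->
  free_action A ->
  irreducibly_quantified phi nu ->
  isomorphic (quotient_space (B1_col_inv phi nu A)) (Hom_Z E phi nu G) /\
  (forall d : nat,
     finitely_generated (abelianization G) ->
     has_rank (abelianization G) d ->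
     exists f : {linear (B1_col_inv phi nu A * ('I_d -> H0_col E phi nu))%type ->
                 Z1_col_inv phi nu A},
       bijective f /\ forall b, f (b, 0) = val b).


Proof.
move=> Eloc /card_gt0P[s0 _] phiI nu0 nu1 _ freeA irr.
have [sg [sgS sgI]] := invariant_form_section s0 Eloc phiI nu0 nu1 freeA irr.
split; first exact: isomorphic_quotient_section sgS sgI.
move=> d _ /(Hom_coordinates E phi nu)[t tb].
exact: splitting_section sgS sgI _ _ tb.
Qed.
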